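(* Let $K$ be a field, let $E$ and $F$ be finite graphs with no sinks, and let $\mathcal L(E)$ and $\mathcal L(F)$ be their Leavitt path algebras over $K$. Then there is an order preserving $\mathbb Z[x,x^{-1}]$-module isomorphism $$K^{\mathrm{gr}}_0(\mathcal L(E\otimes F))\cong K^{\mathrm{gr}}_0(\mathcal L(E))\otimes_{\mathbb Z}K^{\mathrm{gr}}_0(\mathcal L(F))$$ which sends $[\mathcal L(E\otimes F)]$ to $[\mathcal L(E)]\otimes[\mathcal L(F)]$.
   Context: Graphs are directed graphs $E=(E^0,E^1,r,s)$ with vertex set $E^0$, edge set $E^1$, and range and source maps $r,s:E^1\to E^0$. Finite means $E^0$ and $E^1$ are finite. A sink is a vertex emitting no edge. The adjacency matrix of $E$ has $(i,j)$ entry the number of edges from the $i$-th to the $j$-th vertex. Product of graphs: if $E$ and $F$ have adjacency matrices $A=(a_{ij})_{1\le i,j\le m}$ and $B=(b_{lk})_{1\le l,k\le n}$, then $E\otimes F$ is the graph with $mn$ vertices whose adjacency matrix is the Kronecker product $A\otimes B$, i.e. the block matrix whose $(i,j)$ block is $(a_{ij}b_{lk})_{1\le l,k\le n}$. The Leavitt path algebra $\mathcal L(E)$ over $K$ is the $K$-algebra generated by the sets $\{v: v\in E^0\}$, $\{\alpha:\alpha\in E^1\}$, $\{\alpha^*:\alpha\in E^1\}$ subject to: (1) $vw=\delta_{v,w}v$ for $v,w\in E^0$; (2) $s(\alpha)\alpha=\alpha r(\alpha)=\alpha$ and $r(\alpha)\alpha^*=\alpha^*s(\alpha)=\alpha^*$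 for $\alpha\in E^1$; (3) $\alpha^*\beta=\delta_{\alpha,\beta}r(\alpha)$ for $\alpha,\beta\in E^1$; (4) $\sum_{\alpha\in s^{-1}(v)}\alpha\alpha^*=v$ for every $v\in E^0$ with $s^{-1}(v)\neq\emptyset$. It is $\mathbb Z$-graded by $\deg v=0$, $\deg\alpha=1$, $\deg\alpha^*=-1$; for finite $E$ it is unital with identity $\sum_{v\in E^0}v$. For a unital $\mathbb Z$-graded ring $R$, $K_0^{\mathrm{gr}}(R)$ is the group completion of the monoid $\mathcal V^{\mathrm{gr}}(R)$ (under direct sum) of graded isomorphism classes $[P]$ of graded finitely generated projective right $R$-modules. It is a $\mathbb Z[x,x^{-1}]$-module via $x^j[P]=[P(j)]$, where $P(j)_i=P_{i+j}$. Its positive cone $K_0^{\mathrm{gr}}(R)_+$ is the image of $\mathcal V^{\mathrm{gr}}(R)$. $[R]$ is the class of the graded right module $R$. For pre-ordered $\mathbb Z[x,x^{-1}]$-modules $G_1,G_2$ with positive cones $G_1^+,G_2^+$, the group $G_1\otimes_{\mathbb Z}G_2$ is a $\mathbb Z[x,x^{-1}]$-module via $x(g_1\otimes g_2)=xg_1\otimes xg_2$, with positive cone the submonoid of finite sums of elements $g_1\otimes g_2$, $g_1\in G_1^+$, $g_2\in G_2^+$. An order preserving isomorphism means an isomorphism of pre-ordered modules, i.e. one mapping the positive cone onto the positive cone. *)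

(* Defs.v *)
From HB Require Import structures.
From mathcomp Require Import all_boot all_order all_algebra.
From mathcomp Require Import boolp.

Set Implicit Arguments.
Unset Strict Implicit.
Unset Printing Implicit Defensive.

Import GRing.Theory.
Local Open Scope ring_scope.
Local Open Scope quotient_scope.

Record digraph := Digraph {
  vert : finType;
  edge : finType;
  src : edge -> vert;
  rng : edge -> vert }.

Definition no_sinks (E : digraph) := forall v : vert E, exists e, src e = v.

Definition adjacency (E : digraph) (v w : vert E) : nat :=
  #|[set e : edge E | (src e == v) && (rng e == w)]|.

Definition graph_of_adjacency (V : finType) (a : V -> V -> nat) : digraph :=
  @Digraph V {p : V * V & 'I_(a p.1 p.2)}
    (fun e => (tag e).1) (fun e => (tag e).2).

Lemma adjacency_graph_of_adjacency (V : finType) (a : V -> V -> nat) v w :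
  @adjacency (graph_of_adjacency a) v w = a v w.
Proof.
rewrite /adjacency /=.
pose f (k : 'I_(a v w)) : {p : V * V & 'I_(a p.1 p.2)} :=
  @Tagged (V * V)%type (v, w) (fun p => 'I_(a p.1 p.2)) k.
have finj : injective f.
  by move=> k l /eqP; rewrite /f -tag_eqE /tag_eq /= eqxx tagged_asE => /eqP.
rewrite -[RHS]card_ord -(card_imset _ finj).
apply: eq_card => -[[v' w'] k]; rewrite !inE /=.
apply/idP/imsetP => [/andP[/eqP e1 /eqP e2]|[l _ /(congr1 tag) [-> ->]]]; last by rewrite !eqxx.
by subst v' w'; exists k.
Qed.

(* The vertices are pairs rather than integers: the pair (i, l) stands for the
   l-th vertex of the i-th block of the Kronecker product. *)
Definition graph_tensor (E F : digraph) : digraph :=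
  @graph_of_adjacency (vert E * vert F)%type
    (fun p q => adjacency p.1 q.1 * adjacency p.2 q.2)%N.

Lemma adjacency_graph_tensor (E F : digraph) (i j : vert E) (l k : vert F) :
  @adjacency (graph_tensor E F) (i, l) (j, k) = (adjacency i j * adjacency l k)%N.
Proof. exact: adjacency_graph_of_adjacency. Qed.

Section Leavitt.
Variables (K : fieldType) (E : digraph).

Inductive lpa_gen :=
  | LVert of vert E
  | LEdge of edge E
  | LGhost of edge E.

Definition lpa_deg (g : lpa_gen) : int :=
  match g with LVert _ => 0 | LEdge _ => 1 | LGhost _ => -1 end.

(* Terms in the language of K-algebras without unit: the unit is not a
   generator, it turns out to be the sum of the vertices. *)
Inductive lpa_term :=
  | TGen of lpa_gen
  | TZero
  | TAdd of lpa_term & lpa_term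
  | TScale of K & lpa_term
  | TMul of lpa_term & lpa_term.

Notation TV v := (TGen (LVert v)).
Notation TE e := (TGen (LEdge e)).
Notation TG e := (TGen (LGhost e)).

Inductive lpa_eq : lpa_term -> lpa_term -> Prop :=
  | lpa_refl t : lpa_eq t t
  | lpa_sym t u : lpa_eq t u -> lpa_eq u t
  | lpa_trans t u w : lpa_eq t u -> lpa_eq u w -> lpa_eq t w
  | lpa_cAdd t t' u u' :
      lpa_eq t t' -> lpa_eq u u' -> lpa_eq (TAdd t u) (TAdd t' u')
  | lpa_cScale k t t' : lpa_eq t t' -> lpa_eq (TScale k t) (TScale k t')
  | lpa_cMul t t' u u' :
      lpa_eq t t' -> lpa_eq u u' -> lpa_eq (TMul t u) (TMul t' u')
  | lpa_addA t u w : lpa_eq (TAdd t (TAdd u w)) (TAdd (TAdd t u) w)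
  | lpa_addC t u : lpa_eq (TAdd t u) (TAdd u t)
  | lpa_add0 t : lpa_eq (TAdd TZero t) t
  | lpa_addN t : lpa_eq (TAdd (TScale (-1) t) t) TZero
  | lpa_scaleA k l t : lpa_eq (TScale k (TScale l t)) (TScale (k * l) t)
  | lpa_scale1 t : lpa_eq (TScale 1 t) t
  | lpa_scaleDr k t u :
      lpa_eq (TScale k (TAdd t u)) (TAdd (TScale k t) (TScale k u))
  | lpa_scaleDl k l t :
      lpa_eq (TScale (k + l) t) (TAdd (TScale k t) (TScale l t))
  | lpa_mulA t u w : lpa_eq (TMul t (TMul u w)) (TMul (TMul t u) w)
  | lpa_mulDl t u w : lpa_eq (TMul (TAdd t u) w) (TAdd (TMul t w) (TMul u w))
  | lpa_mulDr t u w : lpa_eq (TMul t (TAdd u w)) (TAdd (TMul t u) (TMul t w))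
  | lpa_scaleAl k t u : lpa_eq (TScale k (TMul t u)) (TMul (TScale k t) u)
  | lpa_scaleAr k t u : lpa_eq (TScale k (TMul t u)) (TMul t (TScale k u))
  | lpa_VV v w : lpa_eq (TMul (TV v) (TV w)) (if v == w then TV v else TZero)
  | lpa_sE e : lpa_eq (TMul (TV (src e)) (TE e)) (TE e)
  | lpa_Er e : lpa_eq (TMul (TE e) (TV (rng e))) (TE e)
  | lpa_rG e : lpa_eq (TMul (TV (rng e)) (TG e)) (TG e)
  | lpa_Gs e : lpa_eq (TMul (TG e) (TV (src e))) (TG e)
  | lpa_CK1 e f :
      lpa_eq (TMul (TG e) (TE f)) (if e == f then TV (rng e) else TZero)
  | lpa_CK2 v : (exists e, src e = v) ->
      lpa_eq (\big[TAdd/TZero]_(e | src e == v) TMul (TE e) (TG e)) (TV v).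

HB.instance Definition _ := gen_eqMixin lpa_term.
HB.instance Definition _ := gen_choiceMixin lpa_term.

Definition lpa_eqb : rel lpa_term := fun t u => `[< lpa_eq t u >].

Lemma lpa_eqb_refl : reflexive lpa_eqb.
Proof. by move=> t; apply/asboolP/lpa_refl. Qed.

Lemma lpa_eqb_sym : symmetric lpa_eqb.
Proof. by move=> t u; apply/asboolP/asboolP => /lpa_sym. Qed.

Lemma lpa_eqb_trans : transitive lpa_eqb.
Proof.
by move=> u t w /asboolP h1 /asboolP h2; apply/asboolP; apply: lpa_trans h2.
Qed.

Canonical lpa_equiv := EquivRel lpa_eqb lpa_eqb_refl lpa_eqb_sym lpa_eqb_trans.

Definition leavitt := {eq_quot lpa_equiv}.
HB.instance Definition _ := Choice.on leavitt.

Definition lpa_class (t : lpa_term) : leavitt := \pi_{eq_quot lpa_equiv} t.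
Definition lpa_of_gen (g : lpa_gen) : leavitt := lpa_class (TGen g).
Definition lpa_rep (x : leavitt) : lpa_term := repr (x : {eq_quot lpa_equiv}).

Lemma lpa_repK x : lpa_class (lpa_rep x) = x.
Proof. exact: (@reprK _ {eq_quot lpa_equiv}). Qed.

Lemma lpa_classP t u : lpa_class t = lpa_class u <-> lpa_eq t u.
Proof.
split; last by move=> h; apply/eqquotP/asboolP.
by move=> /eqquotP/asboolP.
Qed.

Lemma lpa_repr t : lpa_eq (lpa_rep (lpa_class t)) t.
Proof. by apply/lpa_classP; rewrite lpa_repK. Qed.

Lemma lpa_classW (P : leavitt -> Prop) : (forall t, P (lpa_class t)) -> forall x, P x.
Proof. by move=> h x; rewrite -[x]lpa_repK; apply: h. Qed.

Definition lpa_add (x y : leavitt) : leavitt := lpa_class (TAdd (lpa_rep x) (lpa_rep y)).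
Definition lpa_mul (x y : leavitt) : leavitt := lpa_class (TMul (lpa_rep x) (lpa_rep y)).
Definition lpa_scale (k : K) (x : leavitt) : leavitt :=
  lpa_class (TScale k (lpa_rep x)).

Lemma lpa_addE t u : lpa_add (lpa_class t) (lpa_class u) = lpa_class (TAdd t u).
Proof. by apply/lpa_classP; apply: lpa_cAdd; apply: lpa_repr. Qed.

Lemma lpa_mulE t u : lpa_mul (lpa_class t) (lpa_class u) = lpa_class (TMul t u).
Proof. by apply/lpa_classP; apply: lpa_cMul; apply: lpa_repr. Qed.

Lemma lpa_scaleE k t : lpa_scale k (lpa_class t) = lpa_class (TScale k t).
Proof. by apply/lpa_classP; apply: lpa_cScale; apply: lpa_repr. Qed.

Lemma lpa_addrA : associative lpa_add.
Proof.
by do 3!elim/lpa_classW=> ?; rewrite !lpa_addE; apply/lpa_classP/lpa_addA.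
Qed.

Lemma lpa_addrC : commutative lpa_add.
Proof.
by do 2!elim/lpa_classW=> ?; rewrite !lpa_addE; apply/lpa_classP/lpa_addC.
Qed.

Lemma lpa_add0r : left_id (lpa_class TZero) lpa_add.
Proof.
by elim/lpa_classW=> ?; rewrite !lpa_addE; apply/lpa_classP/lpa_add0.
Qed.

Lemma lpa_addNr : left_inverse (lpa_class TZero) (lpa_scale (-1)) lpa_add.
Proof.
by elim/lpa_classW=> ?; rewrite lpa_scaleE !lpa_addE; apply/lpa_classP/lpa_addN.
Qed.

HB.instance Definition _ :=
  GRing.isZmodule.Build leavitt lpa_addrA lpa_addrC lpa_add0r lpa_addNr.

Lemma lpa_class0 : lpa_class TZero = 0. Proof. by []. Qed.

Lemma lpa_classD t u : lpa_class (TAdd t u) = lpa_class t + lpa_class u.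
Proof. by rewrite -lpa_addE. Qed.

Lemma lpa_class_sum (I : Type) (r : seq I) (P : pred I) (G : I -> lpa_term) :
  lpa_class (\big[TAdd/TZero]_(i <- r | P i) G i) =
  \sum_(i <- r | P i) lpa_class (G i).
Proof. by apply: (big_morph lpa_class lpa_classD). Qed.

Lemma lpa_scalerA k l x : lpa_scale k (lpa_scale l x) = lpa_scale (k * l) x.
Proof.
by elim/lpa_classW: x => x; rewrite !lpa_scaleE; apply/lpa_classP/lpa_scaleA.
Qed.

Lemma lpa_scale1r : left_id 1 lpa_scale.
Proof.
by elim/lpa_classW=> x; rewrite !lpa_scaleE; apply/lpa_classP/lpa_scale1.
Qed.

Lemma lpa_scalerDr : right_distributive lpa_scale +%R.
Proof.
move=> k; elim/lpa_classW=> x; elim/lpa_classW=> y.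
rewrite -lpa_classD !lpa_scaleE -lpa_classD.
exact/lpa_classP/lpa_scaleDr.
Qed.

Lemma lpa_scalerDl x : {morph lpa_scale^~ x : k l / k + l}.
Proof.
move=> k l; elim/lpa_classW: x => x.
rewrite !lpa_scaleE -lpa_classD.
exact/lpa_classP/lpa_scaleDl.
Qed.

HB.instance Definition _ := GRing.Zmodule_isLmodule.Build K leavitt
  lpa_scalerA lpa_scale1r lpa_scalerDr lpa_scalerDl.

Lemma lpa_classZ k t : lpa_class (TScale k t) = k *: lpa_class t.
Proof. by rewrite -lpa_scaleE. Qed.

Definition lpa_one : leavitt := \sum_(v : vert E) lpa_of_gen (LVert v).

Lemma lpa_mulrA : associative lpa_mul.
Proof.
by do 3!elim/lpa_classW=> ?; rewrite !lpa_mulE; apply/lpa_classP/lpa_mulA.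
Qed.

Lemma lpa_mulrDl : left_distributive lpa_mul +%R.
Proof.
do 3!elim/lpa_classW=> ?; rewrite -lpa_classD !lpa_mulE -lpa_classD.
exact/lpa_classP/lpa_mulDl.
Qed.

Lemma lpa_mulrDr : right_distributive lpa_mul +%R.
Proof.
do 3!elim/lpa_classW=> ?; rewrite -lpa_classD !lpa_mulE -lpa_classD.
exact/lpa_classP/lpa_mulDr.
Qed.

Lemma lpa_scalerAl k x y : k *: lpa_mul x y = lpa_mul (k *: x) y.
Proof.
elim/lpa_classW: x => x; elim/lpa_classW: y => y.
rewrite -[k *: lpa_class x]lpa_classZ !lpa_mulE -lpa_classZ.
exact/lpa_classP/lpa_scaleAl.
Qed.

Lemma lpa_scalerAr k x y : k *: lpa_mul x y = lpa_mul x (k *: y).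
Proof.
elim/lpa_classW: x => x; elim/lpa_classW: y => y.
rewrite -[k *: lpa_class y]lpa_classZ !lpa_mulE -lpa_classZ.
exact/lpa_classP/lpa_scaleAr.
Qed.

Lemma lpa_mul0r : left_zero 0 lpa_mul.
Proof.
move=> x; apply: (@addrI _ (lpa_mul 0 x)).
by rewrite -lpa_mulrDl !addr0.
Qed.

Lemma lpa_mulr0 : right_zero 0 lpa_mul.
Proof.
move=> x; apply: (@addrI _ (lpa_mul x 0)).
by rewrite -lpa_mulrDr !addr0.
Qed.

Lemma lpa_mulVV v w : lpa_mul (lpa_of_gen (LVert v)) (lpa_of_gen (LVert w)) =
  if v == w then lpa_of_gen (LVert v) else 0.
Proof.
by rewrite lpa_mulE; have /lpa_classP -> := lpa_VV v w; case: eqP.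
Qed.

Lemma lpa_mul_suml (I : finType) (f : I -> leavitt) x :
  lpa_mul (\sum_i f i) x = \sum_i lpa_mul (f i) x.
Proof.
apply: (big_morph (lpa_mul^~ x)); last exact: lpa_mul0r.
by move=> ? ?; apply: lpa_mulrDl.
Qed.

Lemma lpa_mul_sumr (I : finType) (f : I -> leavitt) x :
  lpa_mul x (\sum_i f i) = \sum_i lpa_mul x (f i).
Proof.
apply: (big_morph (lpa_mul x)); last exact: lpa_mulr0.
by move=> ? ?; apply: lpa_mulrDr.
Qed.

Lemma lpa_gen_left g : exists v,
  lpa_mul (lpa_of_gen (LVert v)) (lpa_of_gen g) = lpa_of_gen g.
Proof.
case: g => [v|e|e].
- by exists v; rewrite lpa_mulVV eqxx.
- by exists (src e); rewrite lpa_mulE; apply/lpa_classP/lpa_sE.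
- by exists (rng e); rewrite lpa_mulE; apply/lpa_classP/lpa_rG.
Qed.

Lemma lpa_gen_right g : exists v,
  lpa_mul (lpa_of_gen g) (lpa_of_gen (LVert v)) = lpa_of_gen g.
Proof.
case: g => [v|e|e].
- by exists v; rewrite lpa_mulVV eqxx.
- by exists (rng e); rewrite lpa_mulE; apply/lpa_classP/lpa_Er.
- by exists (src e); rewrite lpa_mulE; apply/lpa_classP/lpa_Gs.
Qed.

Lemma lpa_mul1r : left_id lpa_one lpa_mul.
Proof.
elim/lpa_classW=> t; elim: t => [g||t iht u ihu|k t iht|t iht u ihu].
- have [v hv] := lpa_gen_left g; rewrite -[lpa_class _]/(lpa_of_gen g) -hv.
  rewrite lpa_mulrA lpa_mul_suml (bigD1 v) //= lpa_mulVV eqxx big1 ?addr0 //.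
  by move=> w /negbTE nw; rewrite lpa_mulVV nw.
- exact: lpa_mulr0.
- by rewrite lpa_classD lpa_mulrDr iht ihu.
- by rewrite lpa_classZ -lpa_scalerAr iht.
- by rewrite -lpa_mulE lpa_mulrA iht.
Qed.

Lemma lpa_mulr1 : right_id lpa_one lpa_mul.
Proof.
elim/lpa_classW=> t; elim: t => [g||t iht u ihu|k t iht|t iht u ihu].
- have [v hv] := lpa_gen_right g; rewrite -[lpa_class _]/(lpa_of_gen g) -hv.
  rewrite -lpa_mulrA lpa_mul_sumr (bigD1 v) //= lpa_mulVV eqxx big1 ?addr0 //.
  by move=> w; rewrite eq_sym => /negbTE nw; rewrite lpa_mulVV nw.
- exact: lpa_mul0r.
- by rewrite lpa_classD lpa_mulrDl iht ihu.
- by rewrite lpa_classZ -lpa_scalerAl iht.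
- by rewrite -lpa_mulE -lpa_mulrA ihu.
Qed.

(* Only a pzRingType: the algebra of the empty graph is the zero ring. *)
HB.instance Definition _ := GRing.Zmodule_isPzRing.Build leavitt
  lpa_mulrA lpa_mul1r lpa_mulr1 lpa_mulrDl lpa_mulrDr.

Lemma lpa_classM t u : lpa_class (TMul t u) = lpa_class t * lpa_class u.
Proof. by rewrite -lpa_mulE. Qed.

Lemma leavitt_oneE : (1 : leavitt) = \sum_(v : vert E) lpa_of_gen (LVert v).
Proof. by []. Qed.

Lemma leavitt_scalerAl k (x y : leavitt) : k *: (x * y) = (k *: x) * y.
Proof. exact: lpa_scalerAl. Qed.

Lemma leavitt_scalerAr k (x y : leavitt) : k *: (x * y) = x * (k *: y).
Proof. exact: lpa_scalerAr. Qed.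

Inductive lpa_homog : int -> leavitt -> Prop :=
  | homog_gen g : lpa_homog (lpa_deg g) (lpa_of_gen g)
  | homog0 n : lpa_homog n 0
  | homogD n x y : lpa_homog n x -> lpa_homog n y -> lpa_homog n (x + y)
  | homogZ n k x : lpa_homog n x -> lpa_homog n (k *: x)
  | homogM i j x y : lpa_homog i x -> lpa_homog j y -> lpa_homog (i + j) (x * y).

End Leavitt.

Record is_grading (M : zmodType) (C : int -> M -> Prop) : Prop := IsGrading {
  grading0 : forall i, C i 0;
  gradingB : forall i x y, C i x -> C i y -> C i (x - y);
  grading_sum : forall x, exists s : seq (int * M),
    (forall p, p \in s -> C p.1 p.2) /\ x = \sum_(p <- s) p.2;
  grading_direct : forall (s : seq int) (f : int -> M),
    uniq s -> (forall i, C i (f i)) -> \sum_(i <- s) f i = 0 ->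
    forall i, i \in s -> f i = 0 }.

Record grRing := GrRing {
  gr_ring :> pzRingType;
  gr_comp : int -> gr_ring -> Prop;
  gr_grading : is_grading gr_comp;
  gr_one : gr_comp 0 1;
  gr_mul : forall i j x y, gr_comp i x -> gr_comp j y -> gr_comp (i + j) (x * y) }.

(* A right R-module is a left module over the converse ring R^c, so that
   a *: m stands for m a. *)
Record grMod (R : grRing) := GrMod {
  gm_mod :> lmodType R^c;
  gm_comp : int -> gm_mod -> Prop;
  gm_grading : is_grading gm_comp;
  gm_act : forall i j (m : gm_mod) (a : R),
    gm_comp i m -> gr_comp j a -> gm_comp (i + j) ((a : R^c) *: m) }.

Section GradingTheory.
Variables (M : zmodType) (C : int -> M -> Prop) (gC : is_grading C).

Lemma gradingN i x : C i x -> C i (- x).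
Proof. by move=> h; rewrite -sub0r; apply: (gradingB gC) => //; apply: grading0. Qed.

Lemma gradingD i x y : C i x -> C i y -> C i (x + y).
Proof. by move=> h k; rewrite -[y]opprK; apply: (gradingB gC) => //; apply: gradingN. Qed.

Lemma grading_bigsum (I : eqType) (s : seq I) (P : pred I) (f : I -> M) i :
  (forall k, k \in s -> P k -> C i (f k)) -> C i (\sum_(k <- s | P k) f k).
Proof.
move=> h; rewrite big_seq_cond; elim/big_ind: _ => [|x y|k /andP[]].
- exact: (grading0 gC).
- exact: gradingD.
- exact: h.
Qed.

Lemma grading_parts x : exists (s : seq int) (f : int -> M),
  [/\ uniq s, 0 \in s, forall i, C i (f i) & x = \sum_(i <- s) f i].
Proof.
have [s [sC ->]] := grading_sum gC x.
have [u [uu u0 us]] : exists u : seq int,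
    [/\ uniq u, 0 \in u & forall p, p \in s -> p.1 \in u].
  exists (undup (0 :: [seq p.1 | p <- s])).
  split=> [||p ps]; rewrite ?undup_uniq // mem_undup inE ?eqxx //.
  by rewrite map_f ?orbT.
exists u, (fun i => \sum_(p <- s | p.1 == i) p.2); split=> //.
  by move=> i; apply: (grading_bigsum) => p ps /eqP <-; apply: sC.
rewrite (exchange_big_dep predT) //= big_seq [RHS]big_seq.
apply: eq_bigr => p ps.
rewrite -big_filter (eq_filter (a2 := pred1 p.1)); last by move=> i; rewrite /= eq_sym.
by rewrite filter_pred1_uniq ?us // big_seq1.
Qed.

Lemma grading_eq (s : seq int) (f g : int -> M) :
  uniq s -> (forall i, C i (f i)) -> (forall i, C i (g i)) ->
  \sum_(i <- s) f i = \sum_(i <- s) g i -> forall i, i \in s -> f i = g i.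
Proof.
move=> us Cf Cg e i si; apply/eqP; rewrite -subr_eq0; apply/eqP.
apply: (grading_direct gC (f := fun i => f i - g i) us _ _ si).
  by move=> k; apply: (gradingB gC).
by rewrite sumrB e subrr.
Qed.

Lemma grading_shift j : is_grading (fun i => C (i + j)).
Proof.
split=> [i|i x y|x|s f us Cf fs i si]; first exact: (grading0 gC).
- exact: (gradingB gC).
- have [s [sC ->]] := grading_sum gC x.
  exists [seq (p.1 - j, p.2) | p <- s]; split; last by rewrite big_map.
  by move=> q /mapP[p ps ->] /=; rewrite subrK; apply: sC.
have := @grading_direct _ _ gC [seq k + j | k <- s] (fun k => f (k - j)).
move=> /(_ _ _ _ (i + j)); rewrite addrK; apply.
- by rewrite map_inj_uniq //; apply: addIr.
- by move=> k; rewrite -{1}(subrK j k); apply: Cf.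
- by rewrite big_map; under eq_bigr do rewrite addrK.
- exact: (map_f (fun k => k + j)).
Qed.

End GradingTheory.

Section LeavittGrading.
Variables (K : fieldType) (E : digraph).
Notation L := (leavitt K E).

(* A generator acts on Z-indexed families by left multiplication followed by a
   shift by its degree; this representation separates the degrees. *)
Fixpoint lpa_op (t : lpa_term K E) (f : int -> L) : int -> L :=
  match t with
  | TGen g => fun n => lpa_of_gen K g * f (n - lpa_deg g)
  | TZero => fun=> 0
  | TAdd t u => fun n => lpa_op t f n + lpa_op u f n
  | TScale k t => fun n => k *: lpa_op t f n
  | TMul t u => lpa_op t (lpa_op u f)
  end.

Lemma lpa_opD t f g n :
  lpa_op t (fun n => f n + g n) n = lpa_op t f n + lpa_op t g n.
Proof.
elim: t f g n => [x||t iht u ihu|k t iht|t iht u ihu] f g n //=.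
- by rewrite mulrDr.
- by rewrite addr0.
- by rewrite iht ihu addrACA.
- by rewrite iht scalerDr.
- by rewrite -iht; congr (lpa_op t _ n); apply/funext => m; apply: ihu.
Qed.

Lemma lpa_opZ t k f n : lpa_op t (fun n => k *: f n) n = k *: lpa_op t f n.
Proof.
elim: t k f n => [x||t iht u ihu|l t iht|t iht u ihu] k f n //=.
- by rewrite leavitt_scalerAr.
- by rewrite scaler0.
- by rewrite iht ihu scalerDr.
- by rewrite iht !scalerA mulrC.
- by rewrite -iht; congr (lpa_op t _ n); apply/funext => m; apply: ihu.
Qed.

Lemma lpa_op_sum (I : Type) (r : seq I) (P : pred I) G f n :
  lpa_op (\big[@TAdd K E/TZero K E]_(i <- r | P i) G i) f n =
  \sum_(i <- r | P i) lpa_op (G i) f n.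
Proof. by apply: (big_morph (fun t => lpa_op t f n)). Qed.

Lemma lpa_genE (t u : lpa_term K E) : lpa_eq t u -> lpa_class t = lpa_class u.
Proof. by move/lpa_classP. Qed.

Lemma lpa_op_eq t u : lpa_eq t u -> lpa_op t = lpa_op u.
Proof.
elim=> {t u} //=.
- by move=> t u w _ -> _ ->.
- by move=> t t' u u' _ -> _ ->.
- by move=> k t t' _ ->.
- by move=> t t' u u' _ -> _ ->.
- by move=> t u w; apply/funext => f; apply/funext => n; rewrite /= addrA.
- by move=> t u; apply/funext => f; apply/funext => n; rewrite /= addrC.
- by move=> t; apply/funext => f; apply/funext => n; rewrite /= add0r.
- by move=> t; apply/funext => f; apply/funext => n; rewrite /= scaleN1r addNr.
- by move=> k l t; apply/funext => f; apply/funext => n; rewrite /= scalerA.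
- by move=> t; apply/funext => f; apply/funext => n; rewrite /= scale1r.
- by move=> k t u; apply/funext => f; apply/funext => n; rewrite /= scalerDr.
- by move=> k l t; apply/funext => f; apply/funext => n; rewrite /= scalerDl.
- by move=> t u w; apply/funext => f; apply/funext => n; rewrite lpa_opD.
- by move=> k t u; apply/funext => f; apply/funext => n; rewrite lpa_opZ.
- move=> v w; apply/funext => f; apply/funext => n; rewrite /= !subr0 mulrA.
  rewrite -lpa_classM (lpa_genE (lpa_VV K v w)).
  by case: eqP => _ /=; rewrite ?subr0 ?mul0r.
- move=> e; apply/funext => f; apply/funext => n; rewrite /= subr0 mulrA.
  by rewrite -lpa_classM (lpa_genE (lpa_sE K e)).
- move=> e; apply/funext => f; apply/funext => n; rewrite /= subr0 mulrA.
  by rewrite -lpa_classM (lpa_genE (lpa_Er K e)).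
- move=> e; apply/funext => f; apply/funext => n; rewrite /= subr0 mulrA.
  by rewrite -lpa_classM (lpa_genE (lpa_rG K e)).
- move=> e; apply/funext => f; apply/funext => n; rewrite /= subr0 mulrA.
  by rewrite -lpa_classM (lpa_genE (lpa_Gs K e)).
- move=> e e'; apply/funext => f; apply/funext => n; rewrite /= opprK addrK mulrA.
  rewrite -lpa_classM (lpa_genE (lpa_CK1 K e e')).
  by case: eqP => _ /=; rewrite ?subr0 ?mul0r.
- move=> v hv; apply/funext => f; apply/funext => n.
  rewrite lpa_op_sum /= subr0 /lpa_of_gen -(lpa_genE (lpa_CK2 K hv)).
  rewrite lpa_class_sum mulr_suml; apply: eq_bigr => e _.
  by rewrite opprK subrK mulrA -lpa_classM.
Qed.

Definition leavitt_op (x : L) := lpa_op (lpa_rep x).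

Lemma leavitt_opE t : leavitt_op (lpa_class t) = lpa_op t.
Proof. by apply: lpa_op_eq; apply: lpa_repr. Qed.

Lemma leavitt_opD x y f n :
  leavitt_op (x + y) f n = leavitt_op x f n + leavitt_op y f n.
Proof.
elim/lpa_classW: x => x; elim/lpa_classW: y => y.
by rewrite -lpa_classD !leavitt_opE.
Qed.

Lemma leavitt_op_homog d x : lpa_homog d x ->
  forall f n, leavitt_op x f n = x * f (n - d).
Proof.
elim=> {d x} [g|d|d x y _ ihx _ ihy|d k x _ ihx|i j x y _ ihx _ ihy] f n.
- by rewrite /lpa_of_gen leavitt_opE.
- by rewrite -lpa_class0 leavitt_opE lpa_class0 mul0r.
- by rewrite leavitt_opD ihx ihy mulrDl.
- have -> : leavitt_op (k *: x) f n = k *: leavitt_op x f n.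
    by elim/lpa_classW: x {ihx} => x; rewrite -lpa_classZ !leavitt_opE.
  by rewrite ihx leavitt_scalerAl.
- have -> : leavitt_op (x * y) f n = leavitt_op x (leavitt_op y f) n.
    elim/lpa_classW: x {ihx} => x; elim/lpa_classW: y {ihy} => y.
    by rewrite -lpa_classM !leavitt_opE.
  by rewrite ihx ihy mulrA opprD addrA.
Qed.

Lemma lpa_homog_sum (x : L) : exists s : seq (int * L),
  (forall p, p \in s -> lpa_homog p.1 p.2) /\ x = \sum_(p <- s) p.2.
Proof.
elim/lpa_classW: x => t.
elim: t => [g||t [s [hs es]] u [r [hr er]]|k t [s [hs es]]|t [s [hs es]] u [r [hr er]]].
- exists [:: (lpa_deg g, lpa_of_gen K g)]; rewrite big_seq1; split=> //.
  by move=> p; rewrite inE => /eqP ->; apply: homog_gen.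
- by exists [::]; rewrite big_nil.
- exists (s ++ r); rewrite big_cat -es -er lpa_classD; split=> // p.
  by rewrite mem_cat => /orP[/hs|/hr].
- exists [seq (p.1, k *: p.2) | p <- s]; rewrite big_map lpa_classZ es scaler_sumr.
  split=> // q /mapP[p /hs hp ->]; exact: homogZ.
- exists [seq (p.1 + q.1, p.2 * q.2) | p <- s, q <- r].
  split; first by move=> _ /allpairsP[[p q] /= [/hs ? /hr ? ->]]; apply: homogM.
  rewrite big_allpairs_dep /= lpa_classM es er mulr_suml; apply: eq_bigr => p _.
  by rewrite mulr_sumr.
Qed.

Lemma lpa_is_grading : is_grading (@lpa_homog K E).
Proof.
split=> [i|i x y hx hy|x|s f us hf e j js].
- exact: homog0.
- by apply: homogD => //; rewrite -scaleN1r; apply: homogZ.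
- exact: lpa_homog_sum.
pose g (n : int) : L := (n == 0)%:R.
have : leavitt_op (\sum_(i <- s) f i) g j = f j.
  rewrite (big_morph (fun x => leavitt_op x g j) (id1 := 0) (op1 := +%R)).
  - rewrite (bigD1_seq j) //= big1 => [|i nij].
      by rewrite (leavitt_op_homog (hf j)) subrr /g eqxx mulr1 addr0.
    by rewrite (leavitt_op_homog (hf i)) /g subr_eq0 eq_sym (negbTE nij) mulr0.
  - by move=> x y; apply: leavitt_opD.
  - by rewrite (leavitt_op_homog (homog0 K E 0)) mul0r.
by rewrite e (leavitt_op_homog (homog0 K E 0)) mul0r.
Qed.

Lemma lpa_homog1 : @lpa_homog K E 0 1.
Proof.
rewrite leavitt_oneE; elim/big_ind: _ => [|x y|v _]; first exact: homog0.
- exact: homogD.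
- exact: (homog_gen K (LVert v)).
Qed.

Definition leavitt_gr : grRing :=
  @GrRing (leavitt K E) (@lpa_homog K E) lpa_is_grading lpa_homog1
    (fun i j x y => @homogM K E i j x y).

End LeavittGrading.

Section GradedModules.
Variable R : grRing.
Implicit Types M N P : grMod R.

Definition gr_hom M N (f : M -> N) : Prop :=
  linear f /\ forall i m, gm_comp i m -> gm_comp i (f m).

(* The inverse of such an f is again graded. *)
Definition gr_iso M N : Prop := exists f : M -> N, gr_hom f /\ bijective f.

Definition fin_gen M : Prop := exists (n : nat) (g : 'I_n -> M),
  forall m, exists a : 'I_n -> R^c, m = \sum_i a i *: g i.

(* Projective object of the category of graded modules. *)
Definition gr_projective P : Prop :=
  forall (M N : grMod R) (p : M -> N) (f : P -> N),
    gr_hom p -> (forall y, exists x, p x = y) -> gr_hom f ->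
    exists h : P -> M, gr_hom h /\ forall x, p (h x) = f x.

Lemma gr_shift_act (j : int) M i k (m : M) (a : R) :
  gm_comp (i + j) m -> gr_comp k a -> gm_comp (i + k + j) ((a : R^c) *: m).
Proof. by move=> hm ha; rewrite addrAC; apply: gm_act. Qed.

Definition gr_shift (j : int) M : grMod R :=
  @GrMod R M (fun i => @gm_comp R M (i + j))
    (grading_shift (gm_grading M) j) (@gr_shift_act j M).

Section DirectSum.
Variables M N : grMod R.
Let C (i : int) (x : (M * N)%type) := gm_comp i x.1 /\ gm_comp i x.2.

Lemma gr_sum_grading : is_grading C.
Proof.
have gM := gm_grading M; have gN := gm_grading N.
split=> [i|i x y [? ?] [? ?]|[x y]|s f us Cf fs i si].
- by split; [apply: (grading0 gM)|apply: (grading0 gN)].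
- by split; [apply: (gradingB gM)|apply: (gradingB gN)].
- have [s [hs es]] := grading_sum gM x; have [r [hr er]] := grading_sum gN y.
  exists ([seq (p.1, (p.2, 0)) | p <- s] ++ [seq (q.1, (0, q.2)) | q <- r]).
  split.
    move=> p; rewrite mem_cat => /orP[|] /mapP[q hq ->]; split=> /=.
    + exact: hs.
    + exact: (grading0 gN).
    + exact: (grading0 gM).
    + exact: hr.
  rewrite big_cat !big_map /= es er.
  have E1 (t : seq (int * M)) : \sum_(p <- t) ((p.2, 0) : M * N) = (\sum_(p <- t) p.2, 0).
    by elim: t => [|a t ih]; rewrite ?big_nil // !big_cons ih; congr pair; rewrite /= addr0.
  have E2 (t : seq (int * N)) : \sum_(p <- t) ((0, p.2) : M * N) = (0, \sum_(p <- t) p.2).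
    by elim: t => [|a t ih]; rewrite ?big_nil // !big_cons ih; congr pair; rewrite /= addr0.
  by rewrite E1 E2; congr pair; rewrite /= ?addr0 ?add0r.
have f1 : forall t, (\sum_(i <- t) f i).1 = \sum_(i <- t) (f i).1.
  by move=> t; apply: (big_morph (fun x : M * N => x.1)).
have f2 : forall t, (\sum_(i <- t) f i).2 = \sum_(i <- t) (f i).2.
  by move=> t; apply: (big_morph (fun x : M * N => x.2)).
have e1 : (f i).1 = 0.
  apply: (grading_direct gM us _ _ si (f := fun i => (f i).1)) => [k|].
    by case: (Cf k).
  by rewrite -f1 fs.
have e2 : (f i).2 = 0.
  apply: (grading_direct gN us _ _ si (f := fun i => (f i).2)) => [k|].
    by case: (Cf k).
  by rewrite -f2 fs.
by rewrite [f i]surjective_pairing e1 e2.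
Qed.

Lemma gr_sum_act i j (x : (M * N)%type) (a : R) :
  C i x -> gr_comp j a -> C (i + j) ((a : R^c) *: x).
Proof. by case=> h1 h2 ha; split; apply: gm_act. Qed.

Definition gr_sum : grMod R :=
  @GrMod R (M * N)%type C gr_sum_grading gr_sum_act.

End DirectSum.

Lemma gr_regular_act i j (x : (R^c)^o) (a : R) :
  gr_comp i (x : R) -> gr_comp j a -> gr_comp (i + j) (((a : R^c) *: x) : R).
Proof. by move=> hx ha; apply: gr_mul. Qed.

Definition gr_regular : grMod R :=
  @GrMod R (R^c)^o (fun i x => gr_comp i (x : R)) (gr_grading R) gr_regular_act.

Lemma gr_zero_grading : @is_grading 'rV[R^c]_0 (fun _ _ => True).
Proof.
split=> // [x|s f us Cf fs i si]; last by apply/rowP; case.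
by exists [::]; split=> //; apply/rowP; case.
Qed.

Definition gr_zero : grMod R :=
  @GrMod R 'rV[R^c]_0 (fun _ _ => True) gr_zero_grading (fun _ _ _ _ _ _ => I).

Lemma gr_hom0 M N (f : M -> N) : gr_hom f -> f 0 = 0.
Proof. by case=> /(_ (-1) 0 0); rewrite scaler0 addr0 scaleN1r addNr. Qed.

Lemma gr_homD M N (f : M -> N) : gr_hom f -> {morph f : x y / x + y}.
Proof. by case=> lf _ x y; have := lf 1 x y; rewrite !scale1r. Qed.

Lemma gr_homZ M N (f : M -> N) : gr_hom f -> forall (a : R^c) x, f (a *: x) = a *: f x.
Proof. by move=> hf a x; have := hf.1 a x 0; rewrite !addr0 (gr_hom0 hf) addr0. Qed.

Lemma gr_hom_sum M N (f : M -> N) (I : Type) (r : seq I) (P : pred I) (F : I -> M) :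
  gr_hom f -> f (\sum_(i <- r | P i) F i) = \sum_(i <- r | P i) f (F i).
Proof. by move=> hf; apply: (big_morph f (gr_homD hf) (gr_hom0 hf)). Qed.

Lemma gr_hom_comp M N P (f : M -> N) (g : N -> P) :
  gr_hom f -> gr_hom g -> gr_hom (g \o f).
Proof.
move=> [lf gf] [lg gg]; split; first by move=> a x y /=; rewrite lf lg.
by move=> i m hm; apply: gg; apply: gf.
Qed.

Lemma gr_iso_refl M : gr_iso M M.
Proof. by exists id; split=> //; exists id. Qed.

Lemma gr_hom_inv M N (f : M -> N) (g : N -> M) :
  gr_hom f -> cancel f g -> cancel g f -> gr_hom g.
Proof.
move=> hf fK gK; split.
  by move=> a x y; rewrite -[RHS]fK hf.1 !gK.
move=> i n hn.
have [s [h [us s0 Ch eg]]] := grading_parts (gm_grading M) (g n).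
pose t := undup (i :: s).
have ut : uniq t by apply: undup_uniq.
have it : i \in t by rewrite mem_undup mem_head.
pose h' k := if k \in s then h k else 0.
have Ch' k : gm_comp k (h' k).
  by rewrite /h'; case: ifP => _ //; apply: (grading0 (gm_grading M)).
have eg' : g n = \sum_(k <- t) h' k.
  rewrite eg /h' -big_mkcond -big_filter; apply: perm_big.
  apply: uniq_perm => //; first exact: filter_uniq.
  move=> k; rewrite mem_filter mem_undup inE.
  by case: (k \in s) => //=; rewrite orbT.
suff <- : h' i = g n by [].
have fh : forall k, k \in t -> f (h' k) = if k == i then n else 0.
  move=> k kt; apply: (grading_eq (gm_grading N) (f := fun k => f (h' k))
    (g := fun k => if k == i then n else 0) ut _ _ _ kt).
  - by move=> l; apply: hf.2.
  - by move=> l; case: eqP => [->|_] //; apply: (grading0 (gm_grading N)).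
  - rewrite -(gr_hom_sum _ _ _ hf) -eg' gK -big_mkcond /=.
    by rewrite -big_filter filter_pred1_uniq // big_seq1.
by apply: (can_inj fK); rewrite fh // eqxx gK.
Qed.

Lemma gr_iso_sym M N : gr_iso M N -> gr_iso N M.
Proof.
move=> [f [hf [g fK gK]]]; exists g; split; last by exists f.
exact: gr_hom_inv hf fK gK.
Qed.

Lemma gr_iso_trans M N P : gr_iso M N -> gr_iso N P -> gr_iso M P.
Proof.
move=> [f [hf bf]] [g [hg bg]]; exists (g \o f); split; last exact: bij_comp.
exact: gr_hom_comp.
Qed.

Lemma gr_iso_sum M M' N N' :
  gr_iso M M' -> gr_iso N N' -> gr_iso (gr_sum M N) (gr_sum M' N').
Proof.
move=> [f [[lf gf] [f' fK f'K]]] [g [[lg gg] [g' gK g'K]]].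
exists (fun x : gr_sum M N => (f x.1, g x.2) : gr_sum M' N'); split; last first.
  exists (fun x : gr_sum M' N' => (f' x.1, g' x.2) : gr_sum M N).
    by case=> x y /=; rewrite fK gK.
  by case=> x y /=; rewrite f'K g'K.
split; first by move=> a x y; congr pair; [apply: lf|apply: lg].
by move=> i m [h1 h2]; split; [apply: gf|apply: gg].
Qed.

Lemma gr_iso_sumC M N : gr_iso (gr_sum M N) (gr_sum N M).
Proof.
exists (fun x : gr_sum M N => (x.2, x.1) : gr_sum N M); split.
  by split=> // i m [].
by exists (fun x : gr_sum N M => (x.2, x.1) : gr_sum M N); case.
Qed.

Lemma gr_iso_sumA M N P :
  gr_iso (gr_sum M (gr_sum N P)) (gr_sum (gr_sum M N) P).
Proof.
exists (fun x : gr_sum M (gr_sum N P) =>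
  ((x.1, x.2.1), x.2.2) : gr_sum (gr_sum M N) P); split.
  by split=> // i m [? []].
exists (fun x : gr_sum (gr_sum M N) P =>
  (x.1.1, (x.1.2, x.2)) : gr_sum M (gr_sum N P)) => //.
- by case=> ? [].
- by case=> [] [].
Qed.

Lemma gr_iso_sum0 M : gr_iso (gr_sum gr_zero M) M.
Proof.
exists (fun x : gr_sum gr_zero M => x.2); split.
  by split=> // i m [].
exists (fun x : M => (0, x) : gr_sum gr_zero M) => // -[x y] /=.
by congr pair; apply/rowP; case.
Qed.

Lemma gr_iso_shift j M N : gr_iso M N -> gr_iso (gr_shift j M) (gr_shift j N).
Proof.
move=> [f [[lf gf] bf]]; exists f; split=> //; split=> //.
by move=> i m; apply: gf.
Qed.

Lemma gr_iso_shift0 M : gr_iso (gr_shift 0 M) M.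
Proof.
exists id; split; last by exists id.
by split=> // i m /=; rewrite addr0.
Qed.

Lemma gr_iso_shiftD i j M :
  gr_iso (gr_shift (i + j) M) (gr_shift i (gr_shift j M)).
Proof.
exists id; split; last by exists id.
by split=> // k m /=; rewrite addrA.
Qed.

Lemma gr_iso_shift_sum j M N :
  gr_iso (gr_shift j (gr_sum M N)) (gr_sum (gr_shift j M) (gr_shift j N)).
Proof. by exists id; split=> //; exists id. Qed.

Lemma gr_iso_shift_zero j : gr_iso (gr_shift j gr_zero) gr_zero.
Proof. by exists id; split=> //; exists id. Qed.

Lemma fin_gen_iso M N : gr_iso M N -> fin_gen M -> fin_gen N.
Proof.
move=> [f [hf [g fK gK]]] [n [e he]]; exists n, (f \o e) => x.
have [a ea] := he (g x); exists a; rewrite -[x]gK ea gr_hom_sum //.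
by apply: eq_bigr => i _; rewrite gr_homZ.
Qed.

Lemma gr_projective_iso M N : gr_iso M N -> gr_projective M -> gr_projective N.
Proof.
move=> [f [hf [g fK gK]]] pM A B p b hp sp hb.
have hg := gr_hom_inv hf fK gK.
have [h [hh eh]] := pM A B p (b \o f) hp sp (gr_hom_comp hf hb).
exists (h \o g); split; first exact: gr_hom_comp.
by move=> x /=; rewrite eh /= gK.
Qed.

Lemma fin_gen_shift j M : fin_gen M -> fin_gen (gr_shift j M).
Proof. by []. Qed.

Lemma gr_projective_shift j M : gr_projective M -> gr_projective (gr_shift j M).
Proof.
move=> pM A B p b hp sp hb.
have hp' : @gr_hom (gr_shift (- j) A) (gr_shift (- j) B) p.
  by split; [exact: hp.1|move=> i m; apply: hp.2].
have hb' : @gr_hom M (gr_shift (- j) B) b.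
  split; first exact: hb.1.
  by move=> i m hm; apply: hb.2; rewrite /= subrK.
have [h [hh eh]] := pM _ _ _ _ hp' sp hb'.
exists h; split=> //; split; first exact: hh.1.
by move=> i m hm; have := hh.2 _ _ hm; rewrite /= addrK.
Qed.

Lemma fin_gen_sum M N : fin_gen M -> fin_gen N -> fin_gen (gr_sum M N).
Proof.
move=> [m [e he]] [n [f hf]].
exists (m + n)%N, (fun k => match split k with
  | inl i => ((e i, 0) : gr_sum M N) | inr j => (0, f j) end) => -[x y].
have [a ea] := he x; have [b eb] := hf y.
exists (fun k => match split k with inl i => a i | inr j => b j end).
rewrite big_split_ord /=.
under eq_bigr => i _ do rewrite (unsplitK (inl i)).
under [X in _ = _ + X]eq_bigr => i _ do rewrite (unsplitK (inr i)).
have E1 : \sum_i a i *: ((e i, 0) : gr_sum M N) = (x, 0).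
  rewrite ea; elim/big_rec2: _ => //= i u v _ ->.
  by congr pair; rewrite /= scaler0 addr0.
have E2 : \sum_i b i *: ((0, f i) : gr_sum M N) = (0, y).
  rewrite eb; elim/big_rec2: _ => //= i u v _ ->.
  by congr pair; rewrite /= scaler0 addr0.
by rewrite E1 E2; congr pair; rewrite /= ?addr0 ?add0r.
Qed.

Lemma gr_projective_sum M N :
  gr_projective M -> gr_projective N -> gr_projective (gr_sum M N).
Proof.
move=> pM pN A B p b hp sp hb.
have h1 : gr_hom (fun x : M => b ((x, 0) : gr_sum M N)).
  split=> [a x y|i x hx].
    rewrite -hb.1; congr b; congr pair; by rewrite /= scaler0 addr0.
  by apply: hb.2; split=> //; apply: (grading0 (gm_grading N)).
have h2 : gr_hom (fun x : N => b ((0, x) : gr_sum M N)).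
  split=> [a x y|i x hx].
    rewrite -hb.1; congr b; congr pair; by rewrite /= scaler0 addr0.
  by apply: hb.2; split=> //; apply: (grading0 (gm_grading M)).
have [f [hf ef]] := pM _ _ _ _ hp sp h1.
have [g [hg eg]] := pN _ _ _ _ hp sp h2.
exists (fun x : gr_sum M N => f x.1 + g x.2); split.
  split=> [a x y|i x [hx1 hx2]].
    by rewrite /= hf.1 hg.1 scalerDr addrACA.
  by apply: (gradingD (gm_grading A)); [apply: hf.2|apply: hg.2].
move=> [x y]; rewrite /= (gr_homD hp) ef eg -(gr_homD hb).
by congr b; congr pair; rewrite /= ?addr0 ?add0r.
Qed.

Lemma fin_gen_zero : fin_gen gr_zero.
Proof.
exists 0%N, (fun=> 0) => m; exists (fun=> 0).
by apply/rowP; case.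
Qed.

Lemma gr_projective_zero : gr_projective gr_zero.
Proof.
move=> A B p b hp sp hb; exists (fun=> 0); split.
  split=> [a x y|i x _]; first by rewrite scaler0 addr0.
  exact: (grading0 (gm_grading A)).
move=> x; rewrite (gr_hom0 hp) -(gr_hom0 hb); congr b.
by apply/rowP; case.
Qed.

Lemma fin_gen_regular : fin_gen gr_regular.
Proof.
exists 1%N, (fun=> 1) => m; exists (fun=> m).
by rewrite big_ord1; symmetry; apply: (mul1r (m : R)).
Qed.

Lemma gr_projective_regular : gr_projective gr_regular.
Proof.
move=> A B p b hp sp hb.
have [x ex] := sp (b (1 : R)).
have [s [f [us s0 Cf exf]]] := grading_parts (gm_grading A) x.
have pf0 : p (f 0) = b (1 : R).
  have := grading_eq (gm_grading B) (f := fun i => p (f i))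
    (g := fun i => if i == 0 then b (1 : R) else 0) us _ _ _ s0.
  rewrite eqxx; apply.
  - by move=> i; apply: hp.2.
  - move=> i; case: eqP => [->|_]; last exact: (grading0 (gm_grading B)).
    by apply: hb.2; apply: gr_one.
  - rewrite -(gr_hom_sum _ _ _ hp) -exf ex -big_mkcond /=.
    by rewrite -big_filter filter_pred1_uniq // big_seq1.
exists (fun a : gr_regular => (a : R^c) *: f 0); split.
  split=> [a u v|i u hu]; first by rewrite scalerDl -scalerA.
  by have := gm_act (Cf 0) hu; rewrite add0r.
move=> u; rewrite gr_homZ // pf0 -(gr_homZ hb); congr b.
exact: (mul1r (u : R)).
Qed.

End GradedModules.

Section Transport.
Variables (A : pzRingType) (M : lmodType A) (T : choiceType).
Variables (f : T -> M) (g : M -> T) (fK : cancel f g) (gK : cancel g f).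

Definition transported : Type := T.
HB.instance Definition _ := Choice.on transported.

Let add (x y : transported) : transported := g (f x + f y).
Let opp (x : transported) : transported := g (- f x).
Let scale (a : A) (x : transported) : transported := g (a *: f x).

Fact transported_addA : associative add.
Proof. by move=> x y z; rewrite /add !gK addrA. Qed.
Fact transported_addC : commutative add.
Proof. by move=> x y; rewrite /add addrC. Qed.
Fact transported_add0 : left_id (g 0 : transported) add.
Proof. by move=> x; rewrite /add gK add0r fK. Qed.
Fact transported_addN : left_inverse (g 0 : transported) opp add.
Proof. by move=> x; rewrite /add /opp gK addNr. Qed.

HB.instance Definition _ := GRing.isZmodule.Build transported
  transported_addA transported_addC transported_add0 transported_addN.

Fact transported_scaleA a b x : scale a (scale b x) = scale (a * b) x.
Proof. by rewrite /scale gK scalerA. Qed.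
Fact transported_scale1 : left_id 1 scale.
Proof. by move=> x; rewrite /scale scale1r fK. Qed.
Fact transported_scaleDr : right_distributive scale +%R.
Proof. by move=> a x y; rewrite /scale gK scalerDr; congr g; rewrite !gK. Qed.
Fact transported_scaleDl x : {morph scale^~ x : a b / a + b}.
Proof. by move=> a b; rewrite /scale scalerDl; congr g; rewrite !gK. Qed.

HB.instance Definition _ := GRing.Zmodule_isLmodule.Build A transported
  transported_scaleA transported_scale1 transported_scaleDr transported_scaleDl.

Lemma transported_linear : linear (g : M -> transported).
Proof.
move=> a x y; apply: (can_inj fK); rewrite gK.
by rewrite [RHS]gK; congr (_ + _); rewrite ?gK // [RHS]gK gK.
Qed.

Definition transported_class : GRing.Lmodule.axioms_ A T :=
  GRing.Lmodule.class transported.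

End Transport.

Section Vgr.
Variable R : grRing.

(* All graded R-modules form a type too large for their isomorphism classes to
   carry a MathComp structure. We therefore use the modules whose underlying set
   is a set of finite sequences of elements of R; every finitely generated
   graded module is isomorphic to one of these (small_grModP). *)
Record small_grMod := SmallGrMod {
  sm_set : pred (seq R);
  sm_lmod : GRing.Lmodule.axioms_ R^c {x | sm_set x};
  sm_comp : int -> {x | sm_set x} -> Prop;
  sm_grading : @is_grading (GRing.Lmodule.Pack sm_lmod) sm_comp;
  sm_act : forall i j (m : GRing.Lmodule.Pack sm_lmod) (a : R),
    sm_comp i m -> gr_comp j a -> sm_comp (i + j) ((a : R^c) *: m) }.

Coercion grMod_of_small (M : small_grMod) : grMod R :=
  @GrMod R (GRing.Lmodule.Pack (sm_lmod M)) (@sm_comp M)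
    (sm_grading M) (@sm_act M).

Lemma small_grModP (M : grMod R) : fin_gen M ->
  exists M' : small_grMod, gr_iso M M'.
Proof.
move=> [n [e he]]; pose co m := sval (cid (he m)).
have coE m : m = \sum_i co m i *: e i := svalP (cid (he m)).
pose io (m : M) : seq R := [seq co m i | i <- enum 'I_n].
pose S : pred (seq R) := fun s => `[< exists m, io m = s >].
have Sio m : S (io m) by apply/asboolP; exists m.
pose g (m : M) : {x | S x} := exist _ (io m) (Sio m).
have ioI : injective io.
  move=> m m' eio; rewrite (coE m) (coE m'); apply: eq_bigr => i _; congr (_ *: _).
  have coN m1 : nth 0 (io m1) i = co m1 i.
    rewrite /io (nth_map i); last by rewrite size_enum_ord.
    by rewrite nth_ord_enum.
  by rewrite -!coN eio.
have Sx (x : {x | S x}) : exists m, io m = sval x by apply/asboolP; case: x.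
pose f (x : {x | S x}) : M := sval (cid (Sx x)).
have fP x : io (f x) = sval x := svalP (cid (Sx x)).
have fK : cancel f g by move=> x; apply/val_inj; rewrite /= fP.
have gK : cancel g f by move=> m; apply: ioI; rewrite fP.
have gL := transported_linear fK gK.
pose L : lmodType R^c := GRing.Lmodule.Pack (transported_class fK gK).
pose C i (x : L) := gm_comp i (f x).
have gM := gm_grading M.
have fL : linear (f : L -> M).
  by move=> a x y; apply: (can_inj gK); rewrite fK gL !fK.
have f0 : f (0 : L) = 0.
  by have := fL (-1) 0 0; rewrite scaler0 addr0 scaleN1r addNr.
have fD : {morph (f : L -> M) : x y / x + y}.
  by move=> x y; have := fL 1 x y; rewrite !scale1r.
have fZ (a : R^c) (x : L) : f (a *: x) = a *: f x.
  by have := fL a x 0; rewrite addr0 f0 addr0.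
have gD : {morph (g : M -> L) : x y / x + y}.
  by move=> x y; have := gL 1 x y; rewrite !scale1r.
have g0 : (g 0 : L) = 0 by rewrite -f0 fK.
have gC : is_grading C.
  split=> [i|i x y hx hy|x|s h us Ch hs i si].
  - by rewrite /C f0; apply: (grading0 gM).
  - rewrite /C -scaleN1r fD fZ scaleN1r; exact: (gradingB gM).
  - have [s [hs es]] := grading_sum gM (f x).
    exists [seq (p.1, g p.2 : L) | p <- s]; split.
      by move=> q /mapP[p ps ->]; rewrite /C /= gK; apply: hs.
    by rewrite big_map /= -[x]fK es (big_morph (g : M -> L) gD g0).
  - apply: (can_inj fK); rewrite f0.
    apply: (grading_direct gM us _ _ si (f := fun i => f (h i))) => [k|].
      exact: Ch.
    by rewrite -(big_morph (f : L -> M) fD f0) hs.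
have aC i j (m : L) (a : R) : C i m -> gr_comp j a -> C (i + j) ((a : R^c) *: m).
  by move=> hm ha; rewrite /C fZ; apply: gm_act.
exists (@SmallGrMod S (transported_class fK gK) C gC aC).
exists (g : M -> L); split; last by exists (f : L -> M).
by split=> // i m hm; rewrite /= /C gK.
Qed.

Record fgpMod := FgpMod {
  fgp_mod :> grMod R;
  fgp_fin_gen : fin_gen fgp_mod;
  fgp_projective : gr_projective fgp_mod }.

Record small_fgpMod := SmallFgpMod {
  sfgp_mod :> small_grMod;
  sfgp_fin_gen : fin_gen sfgp_mod;
  sfgp_projective : gr_projective sfgp_mod }.

Coercion fgpMod_of_small (M : small_fgpMod) : fgpMod :=
  FgpMod (sfgp_fin_gen M) (@sfgp_projective M).

HB.instance Definition _ := gen_eqMixin small_fgpMod.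
HB.instance Definition _ := gen_choiceMixin small_fgpMod.

Definition vgr_rel : rel small_fgpMod := fun M N => `[< gr_iso M N >].

Lemma vgr_rel_refl : reflexive vgr_rel.
Proof. by move=> M; apply/asboolP/gr_iso_refl. Qed.

Lemma vgr_rel_sym : symmetric vgr_rel.
Proof. by move=> M N; apply/asboolP/asboolP => /gr_iso_sym. Qed.

Lemma vgr_rel_trans : transitive vgr_rel.
Proof.
by move=> N M P /asboolP h1 /asboolP h2; apply/asboolP; apply: gr_iso_trans h2.
Qed.

Canonical vgr_equiv := EquivRel vgr_rel vgr_rel_refl vgr_rel_sym vgr_rel_trans.

Definition Vgr := {eq_quot vgr_equiv}.
HB.instance Definition _ := Choice.on Vgr.

Lemma small_fgpModP (M : fgpMod) : exists M' : small_fgpMod, gr_iso M M'.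
Proof.
have [M' h] := small_grModP (fgp_fin_gen M).
by exists (SmallFgpMod (fin_gen_iso h (fgp_fin_gen M))
  (gr_projective_iso h (@fgp_projective M))).
Qed.

Definition vclass (M : fgpMod) : Vgr :=
  \pi_{eq_quot vgr_equiv} (sval (cid (small_fgpModP M))).

Definition vrep (x : Vgr) : fgpMod := repr (x : {eq_quot vgr_equiv}).

Lemma vclassP (M N : fgpMod) : vclass M = vclass N <-> gr_iso M N.
Proof.
rewrite /vclass; case: cid => M' hM; case: cid => N' hN /=; split.
  move/eqquotP/asboolP => h.
  exact: gr_iso_trans hM (gr_iso_trans h (gr_iso_sym hN)).
move=> h; apply/eqquotP/asboolP.
exact: gr_iso_trans (gr_iso_sym hM) (gr_iso_trans h hN).
Qed.

Lemma vrepK x : vclass (vrep x) = x.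
Proof.
rewrite /vclass; case: cid => M' hM /=.
rewrite -[RHS](@reprK _ {eq_quot vgr_equiv}); apply/eqquotP/asboolP.
exact: gr_iso_sym.
Qed.

Lemma vrep_class M : gr_iso (vrep (vclass M)) M.
Proof. by apply/vclassP; rewrite vrepK. Qed.

Lemma vclassW (P : Vgr -> Prop) : (forall M, P (vclass M)) -> forall x, P x.
Proof. by move=> h x; rewrite -[x]vrepK; apply: h. Qed.

Definition fgp_sum (M N : fgpMod) : fgpMod :=
  FgpMod (fin_gen_sum (fgp_fin_gen M) (fgp_fin_gen N))
    (gr_projective_sum (@fgp_projective M) (@fgp_projective N)).
Definition fgp_zero : fgpMod := FgpMod (fin_gen_zero R) (@gr_projective_zero R).
Definition fgp_regular : fgpMod :=
  FgpMod (fin_gen_regular R) (@gr_projective_regular R).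
Definition fgp_shift (j : int) (M : fgpMod) : fgpMod :=
  FgpMod (fin_gen_shift j (fgp_fin_gen M))
    (gr_projective_shift (j := j) (@fgp_projective M)).

Definition vadd (x y : Vgr) : Vgr := vclass (fgp_sum (vrep x) (vrep y)).

Lemma vaddE M N : vadd (vclass M) (vclass N) = vclass (fgp_sum M N).
Proof. by apply/vclassP; apply: gr_iso_sum; apply: vrep_class. Qed.

Lemma vaddA : associative vadd.
Proof.
by do 3!elim/vclassW=> ?; rewrite !vaddE; apply/vclassP/gr_iso_sumA.
Qed.

Lemma vaddC : commutative vadd.
Proof.
by do 2!elim/vclassW=> ?; rewrite !vaddE; apply/vclassP/gr_iso_sumC.
Qed.

Lemma vadd0 : left_id (vclass fgp_zero) vadd.
Proof.
by elim/vclassW=> ?; rewrite !vaddE; apply/vclassP/gr_iso_sum0.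
Qed.

HB.instance Definition _ := GRing.isNmodule.Build Vgr vaddA vaddC vadd0.

Definition vshift (j : int) (x : Vgr) : Vgr := vclass (fgp_shift j (vrep x)).

Lemma vshiftE j M : vshift j (vclass M) = vclass (fgp_shift j M).
Proof. by apply/vclassP; apply: gr_iso_shift; apply: vrep_class. Qed.

Lemma vclassD M N : vclass M + vclass N = vclass (fgp_sum M N).
Proof. exact: vaddE. Qed.

Lemma vshift_zero j : vshift j 0 = 0.
Proof. by rewrite vshiftE; apply/vclassP/gr_iso_shift_zero. Qed.

Lemma vshift_add j : {morph vshift j : x y / x + y}.
Proof.
do 2!elim/vclassW=> ?; rewrite vclassD !vshiftE vclassD.
exact/vclassP/gr_iso_shift_sum.
Qed.

Lemma vshift0 x : vshift 0 x = x.
Proof. by elim/vclassW: x => M; rewrite vshiftE; apply/vclassP/gr_iso_shift0. Qed.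

Lemma vshiftD i j x : vshift (i + j) x = vshift i (vshift j x).
Proof.
by elim/vclassW: x => M; rewrite !vshiftE; apply/vclassP/gr_iso_shiftD.
Qed.

End Vgr.

Section Completion.
Variable V : nmodType.

Definition gc_rel : rel (V * V)%type :=
  fun p q => `[< exists e, p.1 + q.2 + e = q.1 + p.2 + e >].

Lemma gc_rel_refl : reflexive gc_rel.
Proof. by move=> p; apply/asboolP; exists 0. Qed.

Lemma gc_rel_sym : symmetric gc_rel.
Proof. by move=> p q; apply/asboolP/asboolP => -[e he]; exists e. Qed.

Lemma gc_rel_trans : transitive gc_rel.
Proof.
move=> q p r /asboolP[e he] /asboolP[f hf]; apply/asboolP.
exists (q.1 + q.2 + e + f).
have -> : p.1 + r.2 + (q.1 + q.2 + e + f) = (p.1 + q.2 + e) + (q.1 + r.2 + f).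
  by rewrite (AC (2*(2*1*1)) ((1*4*5)*(3*2*6)))%AC.
by rewrite he hf (AC (3*3) ((4*2)*(1*5*3*6)))%AC.
Qed.

Canonical gc_equiv := EquivRel gc_rel gc_rel_refl gc_rel_sym gc_rel_trans.

Definition group_completion := {eq_quot gc_equiv}.
HB.instance Definition _ := Choice.on group_completion.

Definition gc_diff (a b : V) : group_completion := \pi_{eq_quot gc_equiv} (a, b).

Let rep (x : group_completion) : V * V := repr (x : {eq_quot gc_equiv}).

Lemma gc_diffP a b c d :
  gc_diff a b = gc_diff c d <-> exists e, a + d + e = c + b + e.
Proof.
split; last by move=> h; apply/eqquotP/asboolP.
by move=> /eqquotP/asboolP.
Qed.

Lemma gc_rep x : gc_diff (rep x).1 (rep x).2 = x.
Proof. by rewrite /gc_diff -surjective_pairing; apply: (@reprK _ {eq_quot gc_equiv}). Qed.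

Lemma gc_diffW (P : group_completion -> Prop) :
  (forall a b, P (gc_diff a b)) -> forall x, P x.
Proof. by move=> h x; rewrite -[x]gc_rep; apply: h. Qed.

Definition gc_add (x y : group_completion) : group_completion :=
  gc_diff ((rep x).1 + (rep y).1) ((rep x).2 + (rep y).2).
Definition gc_opp (x : group_completion) : group_completion :=
  gc_diff (rep x).2 (rep x).1.

Lemma gc_addE a b c d :
  gc_add (gc_diff a b) (gc_diff c d) = gc_diff (a + c) (b + d).
Proof.
have /gc_diffP[e he] := gc_rep (gc_diff a b).
have /gc_diffP[f hf] := gc_rep (gc_diff c d).
apply/gc_diffP; exists (e + f).
move: (rep _) (rep _) he hf => q p he hf.
rewrite [LHS](AC (2*2*2) ((1*3*5)*(2*4*6)))%AC /= he hf.
by rewrite (AC (3*3) ((1*4)*(2*5)*(3*6)))%AC.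
Qed.

Lemma gc_oppE a b : gc_opp (gc_diff a b) = gc_diff b a.
Proof.
have /gc_diffP[e he] := gc_rep (gc_diff a b).
apply/gc_diffP; exists e.
by rewrite [(rep _).2 + _]addrC -he [b + _]addrC.
Qed.

Lemma gc_addA : associative gc_add.
Proof. by do 3!elim/gc_diffW=> ? ?; rewrite !gc_addE !addrA. Qed.

Lemma gc_addC : commutative gc_add.
Proof.
elim/gc_diffW=> a b; elim/gc_diffW=> c d.
by rewrite !gc_addE addrC [b + d]addrC.
Qed.

Lemma gc_add0 : left_id (gc_diff 0 0) gc_add.
Proof. by elim/gc_diffW=> ? ?; rewrite gc_addE !add0r. Qed.

Lemma gc_addN : left_inverse (gc_diff 0 0) gc_opp gc_add.
Proof.
elim/gc_diffW=> a b; rewrite gc_oppE gc_addE.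
by apply/gc_diffP; exists 0; rewrite !addr0 add0r addrC.
Qed.

HB.instance Definition _ :=
  GRing.isZmodule.Build group_completion gc_addA gc_addC gc_add0 gc_addN.

Definition gc_inj (a : V) : group_completion := gc_diff a 0.

Lemma gc_diffD a b c d : gc_diff a b + gc_diff c d = gc_diff (a + c) (b + d).
Proof. exact: gc_addE. Qed.

Lemma gc_diffE a b : gc_diff a b = gc_inj a - gc_inj b.
Proof.
have -> : - gc_inj b = gc_diff 0 b by apply: gc_oppE.
by rewrite gc_diffD addr0 add0r.
Qed.

Lemma gc_injD a b : gc_inj (a + b) = gc_inj a + gc_inj b.
Proof. by rewrite gc_diffD addr0. Qed.

Lemma gc_inj0 : gc_inj 0 = 0. Proof. by []. Qed.

Lemma gc_injP a b : gc_inj a = gc_inj b <-> exists e, a + e = b + e.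
Proof. by split=> [/gc_diffP|h]; [|apply/gc_diffP]; rewrite !addr0. Qed.

Definition gc_map (f : V -> V) (x : group_completion) : group_completion :=
  gc_diff (f (rep x).1) (f (rep x).2).

Lemma gc_mapE f a b : {morph f : x y / x + y} ->
  gc_map f (gc_diff a b) = gc_diff (f a) (f b).
Proof.
move=> fD; have /gc_diffP[e he] := gc_rep (gc_diff a b).
by apply/gc_diffP; exists (f e); rewrite -!fD he.
Qed.

End Completion.

(* A Z[x, x^-1]-module is given as an abelian group with the action of the
   monomials x^j; the action of an arbitrary Laurent polynomial is determined by
   additivity, and the module homomorphisms are the additive maps commuting with
   the monomials. *)
Record poZXmod := PoZXmod {
  zx_group :> zmodType;
  zx_act : int -> zx_group -> zx_group;
  zx_actDr : forall j, {morph zx_act j : g h / g + h};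
  zx_act0 : forall g, zx_act 0 g = g;
  zx_actD : forall i j g, zx_act (i + j) g = zx_act i (zx_act j g);
  zx_pos : zx_group -> Prop;
  zx_pos0 : zx_pos 0;
  zx_posD : forall g h, zx_pos g -> zx_pos h -> zx_pos (g + h);
  zx_pos_act : forall j g, zx_pos g -> zx_pos (zx_act j g) }.

Definition order_preserving_iso (G H : poZXmod) (f : G -> H) : Prop :=
  [/\ {morph f : g h / g + h},
      forall j g, f (zx_act j g) = zx_act j (f g),
      bijective f
    & forall h, zx_pos h <-> exists2 g, zx_pos g & f g = h].

Section K0gr.
Variable R : grRing.

Let G : zmodType := group_completion (Vgr R).

Definition k0_act (j : int) : G -> G := gc_map (@vshift R j).
Definition k0_pos (x : G) : Prop := exists a : Vgr R, x = gc_inj a.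

Lemma k0_actE j a b : k0_act j (gc_diff a b) = gc_diff (vshift j a) (vshift j b).
Proof. by apply: gc_mapE; apply: vshift_add. Qed.

Lemma k0_actDr j : {morph k0_act j : g h / g + h}.
Proof.
elim/gc_diffW=> a b; elim/gc_diffW=> c d.
by rewrite gc_diffD !k0_actE gc_diffD !vshift_add.
Qed.

Lemma k0_act0 g : k0_act 0 g = g.
Proof. by elim/gc_diffW: g => a b; rewrite k0_actE !vshift0. Qed.

Lemma k0_actD i j g : k0_act (i + j) g = k0_act i (k0_act j g).
Proof. by elim/gc_diffW: g => a b; rewrite !k0_actE !vshiftD. Qed.

Lemma k0_pos0 : k0_pos 0. Proof. by exists 0. Qed.

Lemma k0_posD g h : k0_pos g -> k0_pos h -> k0_pos (g + h).
Proof. by move=> [a ->] [b ->]; exists (a + b); rewrite gc_injD. Qed.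

Lemma k0_pos_act j g : k0_pos g -> k0_pos (k0_act j g).
Proof.
by move=> [a ->]; exists (vshift j a); rewrite /gc_inj k0_actE vshift_zero.
Qed.

Definition K0gr : poZXmod :=
  @PoZXmod G k0_act k0_actDr k0_act0 k0_actD k0_pos k0_pos0 k0_posD k0_pos_act.

Definition k0_class (M : fgpMod R) : K0gr := gc_inj (vclass M).

Lemma k0_classP (M N : fgpMod R) : k0_class M = k0_class N <->
  exists P : fgpMod R, gr_iso (gr_sum M P) (gr_sum N P).
Proof.
split=> [/gc_injP[e]|[P h]].
  elim/vclassW: e => P; rewrite !vclassD => /vclassP; by exists P.
apply/gc_injP; exists (vclass P); rewrite !vclassD; exact/vclassP.
Qed.

Lemma k0_class_act j M : zx_act j (k0_class M) = k0_class (fgp_shift j M).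
Proof. by rewrite /= /k0_class /gc_inj k0_actE vshift_zero vshiftE. Qed.

End K0gr.

Section Tensor.
Variables U V : zmodType.

Inductive tens_term :=
  | XPure of U & V
  | XZero
  | XAdd of tens_term & tens_term
  | XOpp of tens_term.

Inductive tens_eq : tens_term -> tens_term -> Prop :=
  | tens_refl t : tens_eq t t
  | tens_sym t s : tens_eq t s -> tens_eq s t
  | tens_trans t s r : tens_eq t s -> tens_eq s r -> tens_eq t r
  | tens_cAdd t t' s s' :
      tens_eq t t' -> tens_eq s s' -> tens_eq (XAdd t s) (XAdd t' s')
  | tens_cOpp t t' : tens_eq t t' -> tens_eq (XOpp t) (XOpp t')
  | tens_addA t s r : tens_eq (XAdd t (XAdd s r)) (XAdd (XAdd t s) r)
  | tens_addC t s : tens_eq (XAdd t s) (XAdd s t)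
  | tens_add0 t : tens_eq (XAdd XZero t) t
  | tens_addN t : tens_eq (XAdd (XOpp t) t) XZero
  | tens_pureDl u u' v :
      tens_eq (XPure (u + u') v) (XAdd (XPure u v) (XPure u' v))
  | tens_pureDr u v v' :
      tens_eq (XPure u (v + v')) (XAdd (XPure u v) (XPure u v')).

HB.instance Definition _ := gen_eqMixin tens_term.
HB.instance Definition _ := gen_choiceMixin tens_term.

Definition tens_eqb : rel tens_term := fun t s => `[< tens_eq t s >].

Lemma tens_eqb_refl : reflexive tens_eqb.
Proof. by move=> t; apply/asboolP/tens_refl. Qed.

Lemma tens_eqb_sym : symmetric tens_eqb.
Proof. by move=> t s; apply/asboolP/asboolP => /tens_sym. Qed.

Lemma tens_eqb_trans : transitive tens_eqb.
Proof.
by move=> s t r /asboolP h1 /asboolP h2; apply/asboolP; apply: tens_trans h2.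
Qed.

Canonical tens_equiv := EquivRel tens_eqb tens_eqb_refl tens_eqb_sym tens_eqb_trans.

Definition tensZ := {eq_quot tens_equiv}.
HB.instance Definition _ := Choice.on tensZ.

Definition tens_class (t : tens_term) : tensZ := \pi_{eq_quot tens_equiv} t.
Definition tens_rep (x : tensZ) : tens_term := repr (x : {eq_quot tens_equiv}).

Lemma tens_repK x : tens_class (tens_rep x) = x.
Proof. exact: (@reprK _ {eq_quot tens_equiv}). Qed.

Lemma tens_classP t s : tens_class t = tens_class s <-> tens_eq t s.
Proof.
split; last by move=> h; apply/eqquotP/asboolP.
by move=> /eqquotP/asboolP.
Qed.

Lemma tens_repr t : tens_eq (tens_rep (tens_class t)) t.
Proof. by apply/tens_classP; rewrite tens_repK. Qed.

Lemma tens_classW (P : tensZ -> Prop) : (forall t, P (tens_class t)) -> forall x, P x.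
Proof. by move=> h x; rewrite -[x]tens_repK; apply: h. Qed.

Definition tens_add (x y : tensZ) : tensZ :=
  tens_class (XAdd (tens_rep x) (tens_rep y)).
Definition tens_opp (x : tensZ) : tensZ := tens_class (XOpp (tens_rep x)).

Lemma tens_addE t s : tens_add (tens_class t) (tens_class s) = tens_class (XAdd t s).
Proof. by apply/tens_classP; apply: tens_cAdd; apply: tens_repr. Qed.

Lemma tens_oppE t : tens_opp (tens_class t) = tens_class (XOpp t).
Proof. by apply/tens_classP; apply: tens_cOpp; apply: tens_repr. Qed.

Lemma tens_addrA : associative tens_add.
Proof.
by do 3!elim/tens_classW=> ?; rewrite !tens_addE; apply/tens_classP/tens_addA.
Qed.

Lemma tens_addrC : commutative tens_add.
Proof.
by do 2!elim/tens_classW=> ?; rewrite !tens_addE; apply/tens_classP/tens_addC.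
Qed.

Lemma tens_add0r : left_id (tens_class XZero) tens_add.
Proof.
by elim/tens_classW=> ?; rewrite tens_addE; apply/tens_classP/tens_add0.
Qed.

Lemma tens_addNr : left_inverse (tens_class XZero) tens_opp tens_add.
Proof.
by elim/tens_classW=> ?; rewrite tens_oppE tens_addE; apply/tens_classP/tens_addN.
Qed.

HB.instance Definition _ :=
  GRing.isZmodule.Build tensZ tens_addrA tens_addrC tens_add0r tens_addNr.

Definition tens (u : U) (v : V) : tensZ := tens_class (XPure u v).

Lemma tens_classD t s : tens_class (XAdd t s) = tens_class t + tens_class s.
Proof. by rewrite -tens_addE. Qed.

Lemma tens_classN t : tens_class (XOpp t) = - tens_class t.
Proof. by rewrite -tens_oppE. Qed.

Lemma tens_class0 : tens_class XZero = 0. Proof. by []. Qed.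

Lemma tensDl v : {morph tens^~ v : u u' / u + u'}.
Proof. by move=> u u'; rewrite -tens_classD; apply/tens_classP/tens_pureDl. Qed.

Lemma tensDr u : {morph tens u : v v' / v + v'}.
Proof. by move=> v v'; rewrite -tens_classD; apply/tens_classP/tens_pureDr. Qed.

Lemma tens_ind (P : tensZ -> Prop) :
  (forall u v, P (tens u v)) -> P 0 -> (forall x y, P x -> P y -> P (x + y)) ->
  (forall x, P x -> P (- x)) -> forall x, P x.
Proof.
move=> h1 h0 hD hN; elim/tens_classW=> t; elim: t => [u v||t iht s ihs|t iht].
- exact: h1.
- exact: h0.
- by rewrite tens_classD; apply: hD.
- by rewrite tens_classN; apply: hN.
Qed.

Section Lift.
Variables (W : zmodType) (b : U -> V -> W).
Hypothesis bDl : forall v, {morph b^~ v : u u' / u + u'}.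
Hypothesis bDr : forall u, {morph b u : v v' / v + v'}.

Fixpoint tens_eval (t : tens_term) : W :=
  match t with
  | XPure u v => b u v
  | XZero => 0
  | XAdd t s => tens_eval t + tens_eval s
  | XOpp t => - tens_eval t
  end.

Definition tens_lift (x : tensZ) : W := tens_eval (tens_rep x).

Lemma tens_eval_eq t s : tens_eq t s -> tens_eval t = tens_eval s.
Proof.
elim=> {t s} //=.
- by move=> t s r _ -> _ ->.
- by move=> t t' s s' _ -> _ ->.
- by move=> t t' _ ->.
- by move=> t s r; rewrite addrA.
- by move=> t s; rewrite addrC.
- by move=> t; rewrite add0r.
- by move=> t; rewrite addNr.
- by move=> u u' v; rewrite bDl.
Qed.

Lemma tens_lift_class t : tens_lift (tens_class t) = tens_eval t.
Proof. by apply: tens_eval_eq; apply: tens_repr. Qed.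

Lemma tens_liftE u v : tens_lift (tens u v) = b u v.
Proof. exact: tens_lift_class. Qed.

Lemma tens_liftD : {morph tens_lift : x y / x + y}.
Proof.
do 2!elim/tens_classW=> ?; by rewrite -tens_classD !tens_lift_class.
Qed.

End Lift.

End Tensor.

Lemma morphD_eq_tens (U V W : zmodType) (f g : tensZ U V -> W) :
  {morph f : x y / x + y} -> {morph g : x y / x + y} ->
  (forall u v, f (tens u v) = g (tens u v)) -> f =1 g.
Proof.
move=> fD gD h.
have f0 : f 0 = 0 by apply: (addrI (f 0)); rewrite -fD !addr0.
have g0 : g 0 = 0 by apply: (addrI (g 0)); rewrite -gD !addr0.
elim/tens_ind=> // [|x y hx hy|x hx]; first by rewrite f0 g0.
  by rewrite fD gD hx hy.
by apply: (addrI (f x)); rewrite -fD subrr f0 hx -gD subrr g0.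
Qed.

Section ZXTensor.
Variables G H : poZXmod.

Let b (j : int) (g : G) (h : H) : tensZ G H := tens (zx_act j g) (zx_act j h).

Let bDl j h : {morph (b j)^~ h : u u' / u + u'}.
Proof. by move=> u u'; rewrite /b zx_actDr tensDl. Qed.

Let bDr j g : {morph b j g : u u' / u + u'}.
Proof. by move=> u u'; rewrite /b zx_actDr tensDr. Qed.

Definition zxtens_act (j : int) : tensZ G H -> tensZ G H := tens_lift (b j).

Lemma zxtens_actE j g h : zxtens_act j (tens g h) = tens (zx_act j g) (zx_act j h).
Proof. exact: (tens_liftE (bDl j) (bDr j)). Qed.

Lemma zxtens_actDr j : {morph zxtens_act j : x y / x + y}.
Proof. exact: (tens_liftD (bDl j) (bDr j)). Qed.

Lemma zxtens_act0 x : zxtens_act 0 x = x.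
Proof.
apply: (@morphD_eq_tens _ _ _ (zxtens_act 0) id) => // [|u v].
  exact: zxtens_actDr.
by rewrite zxtens_actE !zx_act0.
Qed.

Lemma zxtens_actD i j x : zxtens_act (i + j) x = zxtens_act i (zxtens_act j x).
Proof.
apply: (@morphD_eq_tens _ _ _ (zxtens_act (i + j)) (zxtens_act i \o zxtens_act j)).
- exact: zxtens_actDr.
- by move=> y z /=; rewrite !zxtens_actDr.
- by move=> u v /=; rewrite !zxtens_actE !zx_actD.
Qed.

Inductive zxtens_pos : tensZ G H -> Prop :=
  | zxtens_pos0 : zxtens_pos 0
  | zxtens_pos_pure g h : zx_pos g -> zx_pos h -> zxtens_pos (tens g h)
  | zxtens_posD x y : zxtens_pos x -> zxtens_pos y -> zxtens_pos (x + y).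

Lemma zxtens_pos_act j x : zxtens_pos x -> zxtens_pos (zxtens_act j x).
Proof.
elim=> {x} [|g h hg hh|x y _ hx _ hy].
- have -> : zxtens_act j 0 = 0.
    by apply: (addrI (zxtens_act j 0)); rewrite -zxtens_actDr !addr0.
  exact: zxtens_pos0.
- by rewrite zxtens_actE; apply: zxtens_pos_pure; apply: zx_pos_act.
- by rewrite zxtens_actDr; apply: zxtens_posD.
Qed.

Definition zx_tensor : poZXmod :=
  @PoZXmod (tensZ G H) zxtens_act zxtens_actDr zxtens_act0 zxtens_actD
    zxtens_pos zxtens_pos0 zxtens_posD zxtens_pos_act.

End ZXTensor.

(* Main.v *)
Require Import Defs.
From HB Require Import structures.
From mathcomp Require Import all_boot all_order all_algebra.
From mathcomp Require Import boolp zify.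

(* For a finite graph without sinks write p_d(v) for the class of the graded
   module vL(E) shifted so that its generator has degree d. The relation
   v = sum_(s(e) = v) e e^* gives p_d(v) = sum_w A(v, w) p_(d+1)(w). Every graded
   finitely generated projective module is a direct sum of such modules at one
   common degree: its coordinate functionals on a finite set of homogeneous
   generators have a Gram matrix over L(E)_0, which becomes a matrix of scalars
   once the generators are multiplied by all paths of a large fixed length, and
   then linear algebra over K removes the superfluous generators. The same
   argument with two bases, together with the fact that no vertex is 0 in L(E),
   shows that the above relations generate all the relations, so that K_0^gr is
   the direct limit of the groups Z^V along the transpose of A, with the limit
   cone. Direct limits commute with tensor products, and the Kronecker product
   of the matrices induces the isomorphism p_d(v, w) |-> p_d(v) (x) p_d(w). *)

Set Implicit Arguments.
Unset Strict Implicit.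
Unset Printing Implicit Defensive.

Import Order.TTheory GRing.Theory Num.Theory.
Local Open Scope ring_scope.

(** * The Leavitt path algebra in degree zero *)

Section LeavittRelations.
Variables (K : fieldType) (E : digraph).
Notation L := (leavitt K E).
Notation vx v := (lpa_of_gen K (LVert v) : L).
Notation ed e := (lpa_of_gen K (LEdge e) : L).
Notation gh e := (lpa_of_gen K (LGhost e) : L).

Lemma vertM v w : vx v * vx w = if v == w then vx v else 0.
Proof. exact: lpa_mulVV. Qed.

Lemma src_edge e : vx (src e) * ed e = ed e.
Proof. by rewrite -lpa_classM; apply/lpa_classP/lpa_sE. Qed.

Lemma edge_rng e : ed e * vx (rng e) = ed e.
Proof. by rewrite -lpa_classM; apply/lpa_classP/lpa_Er. Qed.

Lemma rng_ghost e : vx (rng e) * gh e = gh e.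
Proof. by rewrite -lpa_classM; apply/lpa_classP/lpa_rG. Qed.

Lemma ghost_src e : gh e * vx (src e) = gh e.
Proof. by rewrite -lpa_classM; apply/lpa_classP/lpa_Gs. Qed.

Lemma ghost_edge e f : gh e * ed f = if e == f then vx (rng e) else 0.
Proof.
by rewrite -lpa_classM; have /lpa_classP -> := lpa_CK1 K e f; case: eqP.
Qed.

Lemma vert_edge v e : vx v * ed e = if v == src e then ed e else 0.
Proof. rewrite -{1}[ed e]src_edge mulrA vertM.
by case: eqP => [->|_]; rewrite ?src_edge ?mul0r. Qed.

Lemma sum_edge_ghost v : (exists e, src e = v) ->
  \sum_(e | src e == v) ed e * gh e = vx v.
Proof.
move=> hv; have /lpa_classP := lpa_CK2 K hv; rewrite lpa_class_sum /lpa_of_gen => <-.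
by apply: eq_bigr => e _; rewrite lpa_classM.
Qed.

(* The paths are written as arbitrary sequences of edges: a sequence that is
   not a path gives the product 0. *)
Definition pathE (s : seq (edge E)) : L := \prod_(e <- s) ed e.
Definition pathG (s : seq (edge E)) : L := \prod_(e <- rev s) gh e.

Lemma pathE_cons e s : pathE (e :: s) = ed e * pathE s.
Proof. by rewrite /pathE big_cons. Qed.

Lemma pathG_cons e s : pathG (e :: s) = pathG s * gh e.
Proof. by rewrite /pathG rev_cons -cats1 big_cat big_seq1. Qed.

Lemma pathE_rcons e s : pathE (rcons s e) = pathE s * ed e.
Proof. by rewrite /pathE -cats1 big_cat big_seq1. Qed.

Lemma pathG_rcons e s : pathG (rcons s e) = gh e * pathG s.
Proof. by rewrite /pathG rev_rcons big_cons. Qed.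

Lemma pathE_homog s : lpa_homog (size s)%:Z (pathE s).
Proof.
elim: s => [|e s ih]; first by rewrite /pathE big_nil; apply: lpa_homog1.
rewrite pathE_cons /= -add1n PoszD; apply: homogM => //.
exact: (homog_gen K (LEdge e)).
Qed.

Hypothesis hE : no_sinks E.

Lemma sum_all_edge_ghost : \sum_e ed e * gh e = 1.
Proof.
rewrite leavitt_oneE (partition_big (@src E) predT) //=.
by apply: eq_bigr => v _; apply: sum_edge_ghost; apply: hE.
Qed.

Lemma sum_path n : \sum_(t : n.-tuple (edge E)) pathE t * pathG t = 1.
Proof.
elim: n => [|n ih].
  rewrite (big_pred1 [tuple]); last first.
    by move=> t; apply/esym/eqP; rewrite tuple0.
  by rewrite /pathE /pathG !big_nil mulr1.
rewrite (reindex (fun p : edge E * n.-tuple (edge E) => [tuple of p.1 :: p.2])) /=; last first.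
  exists (fun t : n.+1.-tuple (edge E) => (thead t, [tuple of behead t])).
    by move=> [e t] _; rewrite theadE; congr pair; apply: val_inj.
  by move=> t _; rewrite -tuple_eta.
rewrite -(pair_big predT predT (fun e (t : n.-tuple _) => pathE (e :: t) * pathG (e :: t))) /=.
rewrite -sum_all_edge_ghost; apply: eq_bigr => e _.
rewrite -[in RHS](mulr1 (ed e)) -ih mulr_sumr mulr_suml; apply: eq_bigr => t _.
by rewrite pathE_cons pathG_cons !mulrA.
Qed.

(** The span of the vertices replaces the scalars: multiplication by [vx v] cuts such an element
    down to a multiple of [vx v], which is how Gram entries become elements of K. *)
Definition diagonal (x : L) : Prop :=
  exists c : vert E -> K, x = \sum_v c v *: vx v.

Lemma diagonal0 : diagonal 0.
Proof. by exists (fun=> 0); rewrite big1 // => v _; rewrite scale0r. Qed.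

Lemma diagonalV v : diagonal (vx v).
Proof.
exists (fun w => (w == v)%:R); rewrite (bigD1 v) //= eqxx scale1r big1 ?addr0 //.
by move=> w /negbTE ->; rewrite scale0r.
Qed.

Lemma diagonalD x y : diagonal x -> diagonal y -> diagonal (x + y).
Proof.
move=> [c ->] [d ->]; exists (fun v => c v + d v).
by rewrite -big_split; apply: eq_bigr => v _; rewrite scalerDl.
Qed.

Lemma diagonalZ k x : diagonal x -> diagonal (k *: x).
Proof.
move=> [c ->]; exists (fun v => k * c v).
by rewrite scaler_sumr; apply: eq_bigr => v _; rewrite scalerA.
Qed.

Lemma diagonal_sum (I : Type) (r : seq I) (P : pred I) (f : I -> L) :
  (forall i, P i -> diagonal (f i)) -> diagonal (\sum_(i <- r | P i) f i).
Proof. by move=> h; elim/big_ind: _ => //; [exact: diagonal0|exact: diagonalD]. Qed.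

Lemma vert_diagonal v x : diagonal x -> exists c, vx v * x = c *: vx v.
Proof.
move=> [c ->]; exists (c v).
rewrite mulr_sumr (bigD1 v) //= big1 => [|w nw]; rewrite -leavitt_scalerAr vertM.
  by rewrite eqxx addr0.
by rewrite eq_sym (negbTE nw) scaler0.
Qed.

Lemma diagonalM x y : diagonal x -> diagonal y -> diagonal (x * y).
Proof.
move=> [c ->] dy; rewrite mulr_suml; apply: diagonal_sum => v _.
have [d ed] := vert_diagonal v dy.
by rewrite -leavitt_scalerAl ed; do 2![apply: diagonalZ]; apply: diagonalV.
Qed.

(** The two edges facing the middle vertex either do not match and give 0, or cancel to their range,
    which becomes the middle vertex for the shorter sequences. Equal lengths leave no edge over. *)
Lemma path_vert_path_diagonal s t v : size s = size t ->
  diagonal (pathG s * vx v * pathE t).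
Proof.
elim: s t v => [|e s ih] [|f t] v //=.
  by rewrite /pathG /pathE !big_nil mul1r mulr1 => _; apply: diagonalV.
move=> [est]; rewrite pathG_cons pathE_cons.
rewrite -!mulrA (mulrA (vx v)) vert_edge.
case: eqP => _; last by rewrite mul0r !mulr0; apply: diagonal0.
rewrite (mulrA (gh e)) ghost_edge.
case: eqP => _; last by rewrite mul0r !mulr0; apply: diagonal0.
by rewrite mulrA; apply: ih.
Qed.

Lemma path_path_diagonal s t : size s = size t -> diagonal (pathG s * pathE t).
Proof.
move=> est; rewrite -[pathG s]mulr1 leavitt_oneE mulr_sumr mulr_suml.
by apply: diagonal_sum => v _; apply: path_vert_path_diagonal.
Qed.

(* Compressing a homogeneous element between sufficiently long paths leaves
   only the scalars: this is the finite-dimensional structure of L_0. *)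
Lemma homog_compress d x : @lpa_homog K E d x -> exists n : nat,
  forall s t : seq (edge E), (n <= size s)%N -> (size s)%:Z = (size t)%:Z + d ->
  diagonal (pathG s * x * pathE t).
Proof.
elim=> {d x} [g|d|d x y _ [n ihx] _ [m ihy]|d k x _ [n ihx]|i j x y _ [n ihx] _ [m ihy]].
- exists 0%N => s t _; case: g => [v|e|e] /= est.
  + by apply: path_vert_path_diagonal; lia.
  + by rewrite -mulrA -pathE_cons; apply: path_path_diagonal => /=; lia.
  + by rewrite -pathG_cons; apply: path_path_diagonal => /=; lia.
- by exists 0%N => s t _ _; rewrite mulr0 mul0r; apply: diagonal0.
- exists (maxn n m) => s t; rewrite geq_max => /andP[h1 h2] est.
  by rewrite mulrDr mulrDl; apply: diagonalD; [apply: ihx|apply: ihy].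
- exists n => s t h est.
  by rewrite -leavitt_scalerAr -leavitt_scalerAl; apply: diagonalZ; apply: ihx.
(* The identity, as a sum over paths of length [size s - i], is inserted between x and y; this
   splits the compression of [x * y] into products of compressions of x and of y. The bound keeps
   this length at least m. *)
exists (n + m + `|i|)%N => s t h est.
rewrite mulrA -[_ * x]mulr1 -(sum_path (absz ((size s)%:Z - i))).
rewrite mulr_sumr !mulr_suml; apply: diagonal_sum => p _.
rewrite (_ : _ * pathE t = (pathG s * x * pathE p) * (pathG p * y * pathE t)).
  2: by rewrite !mulrA.
apply: diagonalM.
  by apply: ihx; rewrite ?size_tuple; lia.
by apply: ihy; rewrite ?size_tuple; lia.
Qed.

End LeavittRelations.

(** * Action on infinite paths and nonvanishing of the vertices *)

Section PathRepresentation.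
Variables (K : fieldType) (E : digraph).
Notation epath := (nat -> edge E).

(** The points are arbitrary sequences of edges, so that tails and extensions are total operations;
    the generators act by 0 at the sequences that are not paths. *)
Definition epath_valid (p : epath) : bool :=
  `[< forall n, rng (p n) = src (p n.+1) >].
Definition epath_tail (p : epath) : epath := fun n => p n.+1.
Definition epath_cons (e : edge E) (p : epath) : epath :=
  fun n => if n is k.+1 then p k else e.

Lemma epath_tailK p : epath_cons (p 0%N) (epath_tail p) = p.
Proof. by apply/funext; case. Qed.

Lemma epath_cons_valid e p :
  epath_valid (epath_cons e p) = (src (p 0%N) == rng e) && epath_valid p.
Proof.
apply/asboolP/andP => [h|[/eqP h /asboolP hp] [|n] //=].
by split; [rewrite -(h 0%N)|apply/asboolP => n; apply: (h n.+1)].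
Qed.

Lemma epath_tail_valid p : epath_valid p ->
  (src (epath_tail p 0%N) == rng (p 0%N)) && epath_valid (epath_tail p).
Proof. by rewrite -epath_cons_valid epath_tailK. Qed.

(* L(E) acts on the K-valued functions on infinite paths, an edge by dropping
   the first edge of a path and a ghost edge by prepending one. *)
Fixpoint epath_op (t : lpa_term K E) (f : epath -> K) : epath -> K :=
  match t with
  | TGen (LVert v) => fun p => if (src (p 0%N) == v) && epath_valid p then f p else 0
  | TGen (LEdge e) => fun p => if (p 0%N == e) && epath_valid p then f (epath_tail p) else 0
  | TGen (LGhost e) => fun p =>
      if (src (p 0%N) == rng e) && epath_valid p then f (epath_cons e p) else 0
  | TZero => fun=> 0
  | TAdd t u => fun p => epath_op t f p + epath_op u f p
  | TScale k t => fun p => k * epath_op t f p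
  | TMul t u => epath_op t (epath_op u f)
  end.

Lemma epath_opD t f g p :
  epath_op t (fun p => f p + g p) p = epath_op t f p + epath_op t g p.
Proof.
elim: t f g p => [[v|e|e]||t iht u ihu|k t iht|t iht u ihu] f g p //=.
- by case: ifP; rewrite ?addr0.
- by case: ifP; rewrite ?addr0.
- by case: ifP; rewrite ?addr0.
- by rewrite addr0.
- by rewrite iht ihu addrACA.
- by rewrite iht mulrDr.
- by rewrite -iht; congr (epath_op t _ p); apply/funext => q; apply: ihu.
Qed.

Lemma epath_opZ t k f p : epath_op t (fun p => k * f p) p = k * epath_op t f p.
Proof.
elim: t k f p => [[v|e|e]||t iht u ihu|l t iht|t iht u ihu] k f p //=.
- by case: ifP; rewrite ?mulr0.
- by case: ifP; rewrite ?mulr0.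
- by case: ifP; rewrite ?mulr0.
- by rewrite mulr0.
- by rewrite iht ihu mulrDr.
- by rewrite iht mulrCA.
- by rewrite -iht; congr (epath_op t _ p); apply/funext => q; apply: ihu.
Qed.

Lemma epath_op_eq t u : lpa_eq t u -> epath_op t = epath_op u.
Proof.
elim=> {t u} //=.
- by move=> t u w _ -> _ ->.
- by move=> t t' u u' _ -> _ ->.
- by move=> k t t' _ ->.
- by move=> t t' u u' _ -> _ ->.
- by move=> t u w; apply/funext => f; apply/funext => p; rewrite /= addrA.
- by move=> t u; apply/funext => f; apply/funext => p; rewrite /= addrC.
- by move=> t; apply/funext => f; apply/funext => p; rewrite /= add0r.
- by move=> t; apply/funext => f; apply/funext => p; rewrite /= mulN1r addNr.
- by move=> k l t; apply/funext => f; apply/funext => p; rewrite /= mulrA.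
- by move=> t; apply/funext => f; apply/funext => p; rewrite /= mul1r.
- by move=> k t u; apply/funext => f; apply/funext => p; rewrite /= mulrDr.
- by move=> k l t; apply/funext => f; apply/funext => p; rewrite /= mulrDl.
- by move=> t u w; apply/funext => f; apply/funext => p; rewrite epath_opD.
- by move=> k t u; apply/funext => f; apply/funext => p; rewrite epath_opZ.
- move=> v w; apply/funext => f; apply/funext => p /=.
  case: (v =P w) => [<-|nvw] /=; first by case: (_ && _).
  case: (src (p 0%N) =P v) => //= ->.
  by move/eqP/negbTE: nvw => ->; rewrite if_same.
- move=> e; apply/funext => f; apply/funext => p /=.
  by case: (p 0%N =P e) => [->|_]; rewrite ?eqxx /=; case: (epath_valid p) => //=; case: eqP.
- move=> e; apply/funext => f; apply/funext => p /=.
  case: ifP => // /andP[/eqP <- hp].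
  by rewrite epath_tail_valid.
- move=> e; apply/funext => f; apply/funext => p /=.
  by case: (_ && _).
- move=> e; apply/funext => f; apply/funext => p /=.
  by rewrite epath_cons_valid eqxx /=; case: (_ && _).
- move=> e e'; apply/funext => f; apply/funext => p /=.
  rewrite epath_cons_valid.
  by case: (e =P e') => [->|_] /=; case: (_ && _).
- move=> v hv; apply/funext => f; apply/funext => p /=.
  rewrite (big_morph (fun t => epath_op t f p) (id1 := 0) (op1 := +%R)) //=.
  have [hp|hp] := boolP (epath_valid p); last first.
    by rewrite andbF big1 // => e _; rewrite andbF.
  rewrite andbT; case: (src (p 0%N) =P v) => [h|h].
    (* Only the first edge of the path contributes to the sum: it is removed and put back. *)
    rewrite (bigD1 (p 0%N)) /= ?h // eqxx big1 ?addr0 => [|e /andP[_]].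
      by rewrite epath_tail_valid // epath_tailK.
    by rewrite eq_sym => /negbTE ->.
  rewrite big1 // => e /eqP h'.
  by case: eqP => // he; case: h; rewrite he.
Qed.

Hypothesis hE : no_sinks E.

(** An outgoing edge is chosen at every vertex and followed forever. *)
Lemma epath_from v : exists2 p : epath, src (p 0%N) = v & epath_valid p.
Proof.
have [g hg] := choice hE.
pose p : epath := fun n => iter n (fun e : edge E => g (rng e)) (g v).
exists p; first exact: hg.
by apply/asboolP => n; rewrite [RHS]hg.
Qed.

(** The operator of [c *: v] takes the constant function 1 to a function with value c at any
    infinite path from v. *)
Lemma vert_free (v : vert E) (c : K) : c *: lpa_of_gen K (LVert v) = 0 -> c = 0.
Proof.
rewrite -lpa_classZ -lpa_class0 => /lpa_classP/epath_op_eq.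
have [p hp vp] := epath_from v.
move=> /(congr1 (fun h => h (fun=> 1) p)) /=.
by rewrite hp eqxx vp mulr1.
Qed.

End PathRepresentation.

(** * Frames of graded modules *)

Definition ract (R : grRing) (M : grMod R) (m : M) (a : R) : M := (a : R^c) *: m.
Notation "m *| a" := (ract m a) (at level 40, left associativity).

Section RightAction.
Variables (R : grRing) (M : grMod R).
Implicit Types (m : M) (a b : R).

Lemma ractA m a b : m *| (a * b) = m *| a *| b.
Proof. by rewrite /ract scalerA. Qed.

Lemma ract1 m : m *| 1 = m. Proof. exact: scale1r. Qed.
Lemma ract0 m : m *| 0 = 0. Proof. exact: scale0r. Qed.
Lemma ractN m a : m *| (- a) = - (m *| a). Proof. exact: scaleNr. Qed.
Lemma ract0l a : (0 : M) *| a = 0. Proof. exact: scaler0. Qed.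
Lemma ractDr m a b : m *| (a + b) = m *| a + m *| b. Proof. exact: scalerDl. Qed.
Lemma ractDl m m' a : (m + m') *| a = m *| a + m' *| a. Proof. exact: scalerDr. Qed.

Lemma ract_sumr m (I : Type) (r : seq I) (P : pred I) (f : I -> R) :
  m *| (\sum_(i <- r | P i) f i) = \sum_(i <- r | P i) m *| f i.
Proof. exact: (big_morph _ (ractDr m) (ract0 m)). Qed.

Lemma ract_suml a (I : Type) (r : seq I) (P : pred I) (f : I -> M) :
  (\sum_(i <- r | P i) f i) *| a = \sum_(i <- r | P i) f i *| a.
Proof. exact: (big_morph (fun m => m *| a) (fun m m' => ractDl m m' a) (ract0l a)). Qed.

(** With this shift the elements of degree d have values of degree 0, so the Gram matrix of a family
    in degree d has entries in R_0. *)
Definition functional (d : int) (phi : M -> R) : Prop :=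
  @gr_hom R M (gr_shift (- d) (gr_regular R)) phi.

Variables (d : int) (phi : M -> R).

Lemma functionalI : {morph phi : x y / x + y} ->
  (forall x a, phi (x *| a) = phi x * a) ->
  (forall i x, gm_comp i x -> gr_comp (i - d) (phi x)) -> functional d phi.
Proof.
move=> hD hA hC; split=> // a x y.
by rewrite hD -[a *: x]/(x *| (a : R)) hA.
Qed.

Hypothesis h : functional d phi.

Lemma functionalD : {morph phi : x y / x + y}.
Proof. exact: (gr_homD h). Qed.

Lemma functional0 : phi 0 = 0.
Proof. exact: (gr_hom0 h). Qed.

Lemma functional_act x a : phi (x *| a) = phi x * a.
Proof. exact: (gr_homZ h). Qed.

Lemma functional_sum (I : Type) (r : seq I) (P : pred I) (f : I -> M) :
  phi (\sum_(i <- r | P i) f i) = \sum_(i <- r | P i) phi (f i).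
Proof. exact: (big_morph phi functionalD functional0). Qed.

Lemma functional_homog i x : gm_comp i x -> gr_comp (i - d) (phi x).
Proof. exact: h.2. Qed.

End RightAction.

Lemma gr_hom_act (R : grRing) (M N : grMod R) (f : M -> N) x a :
  gr_hom f -> f (x *| a) = f x *| a.
Proof. by move=> hf; apply: gr_homZ. Qed.

Lemma gr_sum_suml (R : grRing) (M N : grMod R) (I : Type) (r : seq I) (P : pred I)
    (f : I -> M) : \sum_(i <- r | P i) ((f i, 0) : gr_sum M N) =
  (\sum_(i <- r | P i) f i, 0).
Proof.
apply/esym/(big_morph (fun z => (z, 0) : gr_sum M N)) => // x y.
by congr pair; rewrite /= addr0.
Qed.

Lemma gr_sum_sumr (R : grRing) (M N : grMod R) (I : Type) (r : seq I) (P : pred I)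
    (f : I -> N) : \sum_(i <- r | P i) ((0, f i) : gr_sum M N) =
  (0, \sum_(i <- r | P i) f i).
Proof.
apply/esym/(big_morph (fun z => (0, z) : gr_sum M N)) => // x y.
by congr pair; rewrite /= addr0.
Qed.

Definition vertex_count (V I : finType) (S : {set I}) (v : I -> V) (w : V) : nat :=
  #|[set k in S | v k == w]|.

(** The transpose of the adjacency matrix, which is the connecting map of the direct limit. *)
Definition adj_step (E : digraph) (a : vert E -> nat) (w : vert E) : nat :=
  (\sum_u a u * adjacency u w)%N.

Lemma vertex_count_sum (V I : finType) (S : {set I}) (v : I -> V) (W : nmodType)
    (f : V -> W) : \sum_(k in S) f (v k) = \sum_w f w *+ vertex_count S v w.
Proof.
rewrite (partition_big v predT) //=; apply: eq_bigr => w _.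
rewrite /vertex_count -sumr_const; apply: eq_big => [k|k /andP[_ /eqP -> //]].
by rewrite !inE.
Qed.

Section Frames.
Variables (K : fieldType) (E : digraph).
Notation R := (leavitt_gr K E).
Notation L := (leavitt K E).
Notation vx v := (lpa_of_gen K (LVert v) : L).
Notation ed e := (lpa_of_gen K (LEdge e) : L).
Notation gh e := (lpa_of_gen K (LGhost e) : L).

Record framed (M : grMod R) (d : int) (I : finType) (S : {set I})
    (v : I -> vert E) (m : I -> M) (phi : I -> M -> L) : Prop := Framed {
  fr_deg : forall k, gm_comp d (m k);
  fr_vert : forall k, m k *| vx (v k) = m k;
  fr_fun : forall k, @functional R M d (phi k);
  fr_cov : forall k x, vx (v k) * phi k x = phi k x;
  fr_sum : forall x, x = \sum_(k in S) m k *| phi k x }.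

Definition dual_frame (M : grMod R) (I : finType) (S : {set I})
    (v : I -> vert E) (m : I -> M) (phi : I -> M -> L) : Prop :=
  {in S &, forall k l, phi k (m l) = if k == l then vx (v k) else 0}.

Definition refine_set (I : finType) (S : {set I}) (v : I -> vert E) :=
  [set p : I * edge E | (p.1 \in S) && (src p.2 == v p.1)].

Section Refine.
Hypothesis hE : no_sinks E.
Variables (M : grMod R) (d : int) (I : finType) (S : {set I}).
Variables (v : I -> vert E) (m : I -> M) (phi : I -> M -> L).

(** In each term of [fr_sum] the vertex [v k] is inserted by [fr_cov] and expanded as the sum of
    [ed e * gh e]; the left factor joins the generator and the right factor the functional. *)
Lemma framed_refine : framed d S v m phi ->
  framed (d + 1) (refine_set S v) (fun p => rng p.2)
    (fun p => m p.1 *| ed p.2) (fun p x => gh p.2 * phi p.1 x).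
Proof.
case=> hd hv hf hc hs; split.
- by move=> [k e]; apply: gm_act => //; apply: (homog_gen K (LEdge e)).
- by move=> [k e] /=; rewrite -ractA edge_rng.
- move=> [k e] /=; apply: functionalI.
  + by move=> x y; rewrite (functionalD (hf k)) mulrDr.
  + by move=> x a; rewrite (functional_act (hf k)) mulrA.
  + move=> i x hx; have -> : i - (d + 1) = -1 + (i - d) by lia.
    apply: (@homogM K E (-1)); first exact: (homog_gen K (LGhost e)).
    exact: (functional_homog (hf k)).
- by move=> [k e] x /=; rewrite mulrA rng_ghost.
- move=> x; rewrite [LHS]hs.
  rewrite (eq_bigl (fun p => (p.1 \in S) && (src p.2 == v p.1))).
    2: by move=> p; rewrite inE.
  rewrite -(pair_big_dep (fun k => k \in S) (fun k e => src e == v k)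
    (fun k e => m k *| ed e *| (gh e * phi k x))) /=.
  apply: eq_bigr => k _.
  rewrite -[in LHS]hc -(sum_edge_ghost K (hE (v k))) mulr_suml ract_sumr.
  by apply: eq_bigr => e _; rewrite -!ractA mulrA.
Qed.

Lemma dual_refine : framed d S v m phi -> dual_frame S v m phi ->
  dual_frame (refine_set S v) (fun p => rng p.2)
    (fun p => m p.1 *| ed p.2) (fun p x => gh p.2 * phi p.1 x).
Proof.
move=> fr h [k e] [l f]; rewrite !inE /= => /andP[kS /eqP ek] /andP[lS _].
rewrite (functional_act (fr_fun fr k)) h // xpair_eqE.
case: eqP => /= [_|_]; last by rewrite mul0r mulr0.
by rewrite -ek mulrA ghost_src ghost_edge.
Qed.

Lemma vertex_count_refine :
  vertex_count (refine_set S v) (fun p => rng p.2) =1 adj_step (vertex_count S v).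
Proof.
move=> w; rewrite /adj_step.
have -> : (\sum_u vertex_count S v u * adjacency u w =
    \sum_(k in S) adjacency (v k) w)%N.
  rewrite (partition_big v predT) //=; apply: eq_bigr => u _.
  rewrite /vertex_count -sum_nat_const; apply/esym.
  by apply: eq_big => [k|k /andP[_ /eqP -> //]]; rewrite !inE.
rewrite /vertex_count -sum1_card.
rewrite (eq_bigl (fun p => (p.1 \in S) && ((src p.2 == v p.1) && (rng p.2 == w)))).
  rewrite -(pair_big_dep (fun k => k \in S) (fun k e => (src e == v k) && (rng e == w))
    (fun _ _ => 1%N)) /=.
  apply: eq_bigr => k _; rewrite sum1dep_card /adjacency.
  by apply: eq_card => e; rewrite !inE.
by move=> [k e]; rewrite !inE /= andbA.
Qed.

End Refine.

(** The second clause puts every refined Gram entry into the form [pathG s * x * pathE t] with s and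
    t of length n, to which [homog_compress] applies. *)
Lemma framed_refine_iter (hE : no_sinks E) (M : grMod R) (d : int) (I : finType)
    (S : {set I}) v m phi n : @framed M d I S v m phi ->
  exists (I' : finType) (S' : {set I'}) v' m' phi',
  [/\ @framed M (d + n%:Z) I' S' v' m' phi',
      forall k', exists k s, [/\ size s = n, m' k' = m k *| pathE K s
        & forall x, phi' k' x = pathG K s * phi k x],
      dual_frame S v m phi -> dual_frame S' v' m' phi'
    & vertex_count S' v' =1 iter n (@adj_step E) (vertex_count S v)].
Proof.
move=> fr; elim: n => [|n [J [T [w [b [psi [fr' sub du cnt]]]]]]].
  exists I, S, v, m, phi; split=> // [|k]; first by rewrite addr0.
  exists k, [::]; split=> // [|x]; first by rewrite /pathE big_nil ract1.
  by rewrite /pathG big_nil mul1r.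
exists (J * edge E)%type, (refine_set T w), (fun p => rng p.2),
  (fun p => b p.1 *| ed p.2), (fun p x => gh p.2 * psi p.1 x).
split.
- have -> : d + n.+1%:Z = d + n%:Z + 1 by lia.
  exact: framed_refine.
- move=> [j e] /=; have [k [s [hs hb hpsi]]] := sub j.
  exists k, (rcons s e); split; first by rewrite size_rcons hs.
    by rewrite hb pathE_rcons ractA.
  by move=> x; rewrite hpsi pathG_rcons mulrA.
- by move=> /du; apply: (dual_refine fr').
move=> u; rewrite vertex_count_refine iterS /adj_step.
by apply: eq_bigr => z _; rewrite cnt.
Qed.

End Frames.

Lemma fin_eventually (I : finType) (P : I -> nat -> Prop) :
  (forall i, exists n, forall m, (n <= m)%N -> P i m) ->
  exists n, forall m, (n <= m)%N -> forall i, P i m.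
Proof.
move=> h; have [f hf] := choice h; exists (\max_i f i) => m hm i.
by apply: hf; apply: leq_trans hm; apply: leq_bigmax.
Qed.

(** * Comparison and reduction of frames with scalar Gram matrices *)

Section FrameComparison.
Variables (K : fieldType) (E : digraph).
Notation R := (leavitt_gr K E).
Notation L := (leavitt K E).
Notation vx v := (lpa_of_gen K (LVert v) : L).
Hypothesis hE : no_sinks E.
Variable M : grMod R.
Implicit Type d : int.

Lemma framed_scalar d (I : finType) (S : {set I}) v m phi k (x : M) :
  @framed K E M d I S v m phi -> diagonal (phi k x) ->
  exists c, phi k x = c *: vx (v k).
Proof. by move=> fr /(vert_diagonal (v k)); rewrite (fr_cov fr). Qed.

(** The entries [phi k (y j)] have degree 0, and as they are finitely many, one path length
    compresses all of them. *)
Lemma gram_diagonal d (I J : finType) (S : {set I}) v m phi (y : J -> M) :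
  @framed K E M d I S v m phi -> (forall j, gm_comp d (y j)) ->
  exists n0, forall n, (n0 <= n)%N -> forall k j (s t : seq (edge E)),
    size s = n -> size t = n ->
    diagonal (pathG K s * phi k (y j) * pathE K t).
Proof.
move=> fr hy.
have [p|n0 h] := @fin_eventually (I * J)%type (fun p n => forall s t : seq (edge E),
   size s = n -> size t = n ->
    diagonal (pathG K s * phi p.1 (y p.2) * pathE K t)).
  have := functional_homog (fr_fun fr p.1) (hy p.2); rewrite subrr => /(homog_compress hE).
  move=> [n hn]; exists n => k hk s t hs ht; apply: hn; first by rewrite hs.
  by rewrite hs ht addr0.
by exists n0 => n hn k j; apply: (h n hn (k, j)).
Qed.

(** The mixed Gram matrices C and D at the vertex u have entries in K, and duality of the first
    frame gives C D = 1. A matrix with a right inverse has at least as many columns as rows. *)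
Lemma vertex_count_le d (I J : finType) (S : {set I}) (T : {set J}) v w m n phi psi u :
  @framed K E M d I S v m phi -> @framed K E M d J T w n psi ->
  dual_frame S v m phi ->
  (forall k j, diagonal (phi k (n j))) -> (forall j k, diagonal (psi j (m k))) ->
  (vertex_count S v u <= vertex_count T w u)%N.
Proof.
move=> fr fr' du hc he.
have /choice[c0 {}hc] : forall p, exists c, phi p.1 (n p.2) = c *: vx (v p.1).
  by move=> [k j]; apply: framed_scalar fr _; apply: hc.
have /choice[e0 {}he] : forall p, exists e, psi p.1 (m p.2) = e *: vx (w p.1).
  by move=> [j k]; apply: framed_scalar fr' _; apply: he.
rewrite /vertex_count; set A := [set k in S | _]; set B := [set j in T | _].
pose C := \matrix_(i < #|A|, j < #|B|) c0 (enum_val i, enum_val j).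
pose D := \matrix_(j < #|B|, i < #|A|) e0 (enum_val j, enum_val i).
apply: (@mulmx1_min K _ _ C D).
apply/matrixP => i i'; rewrite !mxE.
have hA i1 : enum_val i1 \in S /\ v (@enum_val _ (mem A) i1) = u.
  by have := enum_valP i1; rewrite inE => /andP[? /eqP].
have [kS ku] := hA i; have [lS lu] := hA i'.
set k := enum_val i in kS ku *; set l := enum_val i' in lS lu *.
have e : \sum_j C i j * D j i' = \sum_(j in B) c0 (k, j) * e0 (j, l).
  by rewrite [RHS]big_enum_val; apply: eq_bigr => j _; rewrite !mxE.
(* The scalar identity is checked after multiplication by the vertex u, where it becomes the
   expansion of [phi k (m l)] in the second frame; only the j at the vertex u contribute. *)
rewrite e; apply/eqP; rewrite -subr_eq0; apply/eqP; apply: (@vert_free K E hE u).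
rewrite scalerBl scaler_suml.
have := du k l kS lS; rewrite [in LHS](fr_sum fr' (m l)).
rewrite (functional_sum (fr_fun fr k)) /=.
rewrite (eq_bigr (fun j => if w j == u then (c0 (k, j) * e0 (j, l)) *: vx u else 0)).
  rewrite -big_mkcondr /=.
  rewrite (eq_bigl (mem B)) => [-> /=|j]; last by rewrite !inE.
  rewrite ku (inj_eq enum_val_inj).
  by case: eqP => _; rewrite ?scale1r ?scale0r subrr.
move=> j jT; rewrite (functional_act (fr_fun fr k)) (hc (k, j)) (he (j, l)) /= ku.
rewrite -leavitt_scalerAl -leavitt_scalerAr vertM scalerA eq_sym.
by case: eqP => // _; rewrite scaler0.
Qed.

(** Both frames are refined until their mixed Gram matrices are scalar; the vertex counts are then
    compared in both directions. *)
Lemma dual_frame_unique d (I J : finType) (S : {set I}) (T : {set J}) v w m n phi psi :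
  @framed K E M d I S v m phi -> @framed K E M d J T w n psi ->
  dual_frame S v m phi -> dual_frame T w n psi ->
  exists k, iter k (@adj_step E) (vertex_count S v) =1
            iter k (@adj_step E) (vertex_count T w).
Proof.
move=> fr fr' du du'.
have [n1 h1] := gram_diagonal fr (fr_deg fr').
have [n2 h2] := gram_diagonal fr' (fr_deg fr).
exists (maxn n1 n2) => u.
have [I1 [S1 [v1 [m1 [phi1 [fr1 sub1 du1 <-]]]]]] := framed_refine_iter hE (maxn n1 n2) fr.
have [J1 [T1 [w1 [o1 [psi1 [fr2 sub2 du2 <-]]]]]] := framed_refine_iter hE (maxn n1 n2) fr'.
have g1 k j : diagonal (phi1 k (o1 j)).
  have [k0 [s [hs _ ->]]] := sub1 k; have [j0 [t [ht -> _]]] := sub2 j.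
  by rewrite (functional_act (fr_fun fr k0)) mulrA; apply: h1 ht => //; apply: leq_maxl.
have g2 j k : diagonal (psi1 j (m1 k)).
  have [k0 [s [hs -> _]]] := sub1 k; have [j0 [t [ht _ ->]]] := sub2 j.
  by rewrite (functional_act (fr_fun fr' j0)) mulrA; apply: h2 hs => //; apply: leq_maxr.
apply/eqP; rewrite eqn_leq (vertex_count_le _ fr1 fr2 (du1 du)) //=.
by rewrite (vertex_count_le _ fr2 fr1 (du2 du')).
Qed.

(** Graded modules carry no K-structure of their own, so a scalar acts through its multiple of 1. *)
Definition scal (c : K) : R := c *: (1 : L).

Lemma scalM c (x : L) : scal c * x = c *: x.
Proof. by rewrite /scal -leavitt_scalerAl mul1r. Qed.

Lemma mul_scal c (x : L) : x * scal c = c *: x.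
Proof. by rewrite /scal -leavitt_scalerAr mulr1. Qed.

(* A frame with scalar Gram matrix which is not dual has a K-linear relation
   between elements of the same vertex; solving it for one of them makes that
   element superfluous. *)
Lemma frame_shrink d (I : finType) (S : {set I}) v m phi :
  @framed K E M d I S v m phi -> (forall k l, diagonal (phi k (m l))) ->
  exists (S' : {set I}) phi', @framed K E M d I S' v m phi' /\ dual_frame S' v m phi'.
Proof.
have [N] := ubnP #|S|; elim: N => // N IH in S phi *.
move=> cardS fr hg.
have [du|ndu] := pselect (dual_frame S v m phi); first by exists S, phi.
have /choice[c0 hc] : forall p, exists c, phi p.1 (m p.2) = c *: vx (v p.1).
  by move=> [k l]; apply: framed_scalar fr _; apply: hg.
have [j [l [jS lS hjl]]] : exists j l, [/\ j \in S, l \in S &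
    phi j (m l) <> if j == l then vx (v j) else 0].
  apply: contrapT => h; apply: ndu => j l jS lS; apply: contrapT => h'.
  by apply: h; exists j, l.
(* Column l of the Gram matrix minus the identity, cut down to the vertex of l. Expanding [m l] in
   the frame shows that these are the coefficients of a linear relation. *)
pose b k := if v k == v l then c0 (k, l) - (k == l)%:R else 0.
have phi_vl k : phi k (m l) = if v k == v l then c0 (k, l) *: vx (v k) else 0.
  have : phi k (m l) * vx (v l) = phi k (m l).
    by rewrite -(functional_act (fr_fun fr k)) (fr_vert fr).
  rewrite (hc (k, l)) /= -leavitt_scalerAl vertM => <-.
  by case: eqP => //; rewrite scaler0.
have bphi k : b k *: vx (v k) = phi k (m l) - if k == l then vx (v k) else 0.
  rewrite phi_vl /b; case: (v k =P v l) => [_|nvv].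
    by rewrite scalerBl; case: (k == l); rewrite ?scale1r ?scale0r.
  by rewrite scale0r; case: eqP => [kl|]; [rewrite kl in nvv|rewrite subr0].
have bj : b j != 0.
  apply/eqP => bj0; apply: hjl; apply/eqP; rewrite -subr_eq0.
  by rewrite -bphi bj0 scale0r.
have bv k : b k != 0 -> v k = v l by rewrite /b; case: (v k =P v l) => //; rewrite eqxx.
have vjl := bv j bj.
have rel : \sum_(k in S) m k *| scal (b k) = 0.
  rewrite (eq_bigr (fun k => m k *| phi k (m l) + m k *| scal (- (k == l)%:R))).
    rewrite big_split -(fr_sum fr (m l)) (bigD1 l) //= big1 => [|k /andP[_ /negbTE ->]].
      by rewrite addr0 -{1}[m l]ract1 -ractDr eqxx /scal scaleN1r subrr ract0.
    by rewrite /scal oppr0 scale0r ract0.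
  move=> k kS; rewrite -{1}(fr_vert fr k) -ractA mul_scal bphi ractDr; congr (_ + _).
  rewrite /scal; case: eqP => [_|_]; last by rewrite !oppr0 scale0r ract0.
  rewrite scaleN1r -(mulr1 (- vx _)) mulNr -mulrN ractA.
  by rewrite (fr_vert fr).
(* The relation solved for [m j]. Nonzero coefficients occur only at the vertex of j, so adding
   [a k] times [phi j] to [phi k] preserves [fr_cov], and j can be removed. *)
pose a k := - (b k / b j).
have av k : a k != 0 -> v k = v j.
  rewrite vjl => ak; apply: bv; apply: contra_neq ak => bk.
  by rewrite /a bk mul0r oppr0.
have avx k x : a k *: (vx (v k) * x) = a k *: (vx (v j) * x).
  by have [->|/av ->] := eqVneq (a k) 0; rewrite ?scale0r.
have mj : m j = \sum_(k in S :\ j) m k *| scal (a k).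
  have : (\sum_(k in S) m k *| scal (b k)) *| scal (- (b j)^-1) = 0.
    by rewrite rel ract0l.
  rewrite ract_suml (bigD1 j) //= -ractA.
  rewrite scalM /scal scalerA mulrN mulfV // scaleN1r ractN ract1.
  move=> /eqP; rewrite addrC subr_eq0 => /eqP <-.
  apply: eq_big => [k|k _]; first by rewrite !inE andbC.
  by rewrite -ractA scalM /scal scalerA mulrN.
pose phi' k x := phi k x + scal (a k) * phi j x.
apply: (IH (S :\ j) phi').
- by rewrite (cardsD1 j S) jS add1n ltnS in cardS.
- split.
  + exact: (fr_deg fr).
  + exact: (fr_vert fr).
  + move=> k; apply: functionalI.
    * move=> x y; rewrite /phi' !(functionalD (fr_fun fr _)) mulrDr addrACA //.
    * by move=> x c; rewrite /phi' !(functional_act (fr_fun fr _)) mulrDl mulrA.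
    * move=> i x hx; apply: (gradingD (gr_grading R)).
        exact: (functional_homog (fr_fun fr k)).
      by rewrite scalM; apply: homogZ; apply: (functional_homog (fr_fun fr j)).
  + move=> k x; rewrite /phi' mulrDr (fr_cov fr) scalM -leavitt_scalerAr avx.
    by rewrite (fr_cov fr).
  + move=> x; rewrite {1}(fr_sum fr x) (bigD1 j) //= {1}mj ract_suml.
    rewrite addrC [X in X + _](eq_bigl (mem (S :\ j))).
      2: by move=> k; rewrite !inE andbC.
    by rewrite -big_split; apply: eq_bigr => k _; rewrite /= ractDr ractA.
move=> k i; apply: diagonalD; first exact: hg.
by rewrite scalM; apply: diagonalZ; apply: hg.
Qed.

End FrameComparison.

(** * Existence of dual frames *)

Section FreeCover.
Variables (R : grRing) (M : grMod R) (d : int).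

(** F is the graded free module on n generators of degree d, built by adding one shifted copy of R
    at a time. Families indexed by natural numbers are extended in the induction without
    reindexing. *)
Lemma free_cover n (y : nat -> M) : (forall i, (i < n)%N -> gm_comp d (y i)) ->
  exists (F : grMod R) (f : nat -> F) (psi : nat -> F -> R) (pr : F -> M),
  [/\ forall i, (i < n)%N -> functional d (psi i),
      gr_hom pr,
      forall i, (i < n)%N -> pr (f i) = y i
    & forall x, x = \sum_(i < n) f i *| psi i x].
Proof.
elim: n => [|n IH] hy.
  exists (gr_zero R), (fun=> 0), (fun _ _ => 0), (fun=> 0); split=> // [|x].
    by split=> [a u w|i x _]; rewrite ?scaler0 ?addr0 //; apply: grading0 (gm_grading M) i.
  by apply/rowP; case.
have [|F [f [psi [pr [hpsi hpr hf hs]]]]] := IH.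
  by move=> i hi; apply: hy; apply: ltnW.
pose F' := gr_sum F (gr_shift (- d) (gr_regular R)).
exists F', (fun i => (if (i < n)%N then (f i, 0) else (0, 1 : R)) : F'),
  (fun i x => if (i < n)%N then psi i x.1 else x.2),
  (fun x => pr x.1 + y n *| x.2); split.
- move=> i _; case: (ltnP i n) => hi; last first.
    by apply: functionalI => // k x [].
  have h := hpsi i hi; apply: functionalI => [x z|x a|k x []].
  + exact: (functionalD h).
  + exact: (functional_act h x.1).
  + by move=> hx _; apply: (functional_homog h).
- split=> [a u w|i x [h1 h2]].
    rewrite /= hpr.1 ractDr scalerDr addrACA; congr (_ + _ + _).
    exact: (ractA (y n) (u.2 : R) (a : R)).
  apply: (gradingD (gm_grading M)); first exact: hpr.2.
  have -> : i = d + (i - d) by lia.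
  by apply: gm_act => //; apply: hy.
- move=> i; rewrite ltnS leq_eqVlt => /orP[/eqP ->|hi].
    by rewrite ltnn /= (gr_hom0 hpr) add0r; apply: ract1.
  by rewrite hi /= hf // ract0 addr0.
move=> x; rewrite big_ord_recr /= ltnn.
rewrite (eq_bigr (fun i : 'I_n => ((f i *| psi i x.1, 0) : F'))); last first.
  by move=> i _; rewrite ltn_ord; congr pair; rewrite /= scaler0.
rewrite gr_sum_suml -(hs x.1).
rewrite [LHS]surjective_pairing; congr pair; rewrite /=.
  by rewrite scaler0 addr0.
by rewrite add0r; apply/esym; apply: (mul1r (x.2 : R)).
Qed.

(** The graded dual basis lemma: a graded splitting of the free cover, composed with the coordinates
    of the free module. *)
Lemma projective_coordinates n (y : nat -> M) : gr_projective M ->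
  (forall i, (i < n)%N -> gm_comp d (y i)) ->
  (forall x, exists a : nat -> R, x = \sum_(i < n) y i *| a i) ->
  exists phi : nat -> M -> R,
  (forall i, (i < n)%N -> functional d (phi i)) /\
  forall x, x = \sum_(i < n) y i *| phi i x.
Proof.
move=> pM hy gen; have [F [f [psi [pr [hpsi hpr hf hs]]]]] := free_cover hy.
have pr_sum (a : nat -> R) : pr (\sum_(i < n) f i *| a i) = \sum_(i < n) y i *| a i.
  rewrite (gr_hom_sum _ _ _ hpr); apply: eq_bigr => i _.
  by rewrite (gr_hom_act _ _ hpr) hf.
have sur x : exists u, pr u = x.
  by have [a ->] := gen x; exists (\sum_(i < n) f i *| a i).
have [h [hh eh]] := pM _ _ pr id hpr sur (conj (fun _ _ _ => erefl) (fun _ _ h => h)).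
exists (fun i x => psi i (h x)); split=> [i hi|x].
  exact: gr_hom_comp hh (hpsi i hi).
by rewrite -[LHS]eh {1}(hs (h x)) (pr_sum (fun i => psi i (h x))).
Qed.

End FreeCover.

Section FrameExistence.
Variables (K : fieldType) (E : digraph).
Notation R := (leavitt_gr K E).
Notation L := (leavitt K E).
Notation vx v := (lpa_of_gen K (LVert v) : L).
Hypothesis hE : no_sinks E.
Variable M : grMod R.

Definition spanned (d : int) (x : M) : Prop := exists s : seq (M * L),
  (forall p, p \in s -> gm_comp d p.1) /\ x = \sum_(p <- s) p.1 *| (p.2 : R).

(** The expansion of 1 over the paths of length n writes x as a combination of the elements
    [x *| pathE K t], which have degree d + n. *)
Lemma spanned_homog d (n : nat) x : gm_comp d x -> spanned (d + n%:Z) x.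
Proof.
move=> hx; exists [seq (x *| (pathE K t : R), pathG K t) | t : n.-tuple (edge E)].
split.
  move=> p /mapP[t _ ->] /=; apply: gm_act => //.
  by have := pathE_homog K t; rewrite size_tuple.
rewrite big_image /= -[LHS]ract1 -[1 in LHS](sum_path K hE n) ract_sumr.
by apply: eq_bigr => t _; rewrite ractA.
Qed.

Lemma spanned_eventually x : exists n0, forall n, (n0 <= n)%N -> spanned n%:Z x.
Proof.
have [s [hs ->]] := grading_sum (gm_grading M) x; elim: s hs => [|p s IH] hs.
  by exists 0%N => n _; exists [::]; rewrite !big_nil.
have [|n0 h] := IH; first by move=> q qs; apply: hs; rewrite inE qs orbT.
exists (maxn n0 `|p.1|) => n; rewrite geq_max => /andP[h1 h2].
have [s1 [hs1 e1]] := h n h1.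
have [s2 [hs2 e2]] : spanned n%:Z p.2.
  have -> : n%:Z = p.1 + (absz (n%:Z - p.1))%:Z by lia.
  by apply: spanned_homog; apply: hs; apply: mem_head.
exists (s2 ++ s1); split; last by rewrite big_cons big_cat /= -e2 -e1.
by move=> q; rewrite mem_cat => /orP[/hs2|/hs1].
Qed.

Lemma homogeneous_generators : fin_gen M -> exists (d : int) (s : seq M),
  (forall i, (i < size s)%N -> gm_comp d s`_i) /\
  forall x, exists a : nat -> R, x = \sum_(i < size s) s`_i *| a i.
Proof.
move=> [n [g hg]].
have [|d hd] := @fin_eventually 'I_n (fun i n => spanned n%:Z (g i)).
  by move=> i; apply: spanned_eventually.
have /choice[f hf] := hd d (leqnn d).
(* Pairs of a generator and a coefficient for the combination of the [g i] with coefficients [b i].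
   The first components do not depend on b, so one list of generators serves every element. *)
pose t (b : 'I_n -> R) : seq (M * L) :=
  flatten [seq [seq (p.1, (p.2 : L) * b i) | p <- f i] | i : 'I_n].
pose s : seq M := [seq p.1 | p <- t (fun=> 0)].
have ts b : s = [seq p.1 | p <- t b].
  rewrite /s /t !map_flatten; congr flatten; rewrite -!map_comp; apply: eq_map => i /=.
  by rewrite -!map_comp; apply: eq_map.
exists d%:Z, s; split=> [i hi|x].
  have /mapP[p] := mem_nth 0 hi; rewrite /t => /flatten_mapP[k _ /mapP[q qf ->]] ->.
  by have [h _] := hf k; apply: (h q).
have [b eb] := hg x; rewrite (ts b) size_map.
exists (fun i => (nth (0, 0) (t b) i).2).
transitivity (\sum_(p <- t b) p.1 *| (p.2 : R)); last first.
  rewrite (big_nth (0, 0)) big_mkord; apply: eq_bigr => i _.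
  by rewrite (nth_map (0, 0)).
rewrite big_flatten big_image /= eb; apply: eq_bigr => i _.
rewrite big_map /=; have [_ ->] := hf i.
rewrite -[_ *: _]/(_ *| (b i : R)) ract_suml; apply: eq_bigr => p _.
by rewrite ractA.
Qed.

Lemma frame_exists : fin_gen M -> gr_projective M -> exists (d : int) (I : finType)
  (S : {set I}) v m phi, @framed K E M d I S v m phi /\ dual_frame S v m phi.
Proof.
move=> fM pM; have [d [s [hs gen]]] := homogeneous_generators fM.
have [phi [hphi sphi]] := projective_coordinates pM hs gen.
(* Each homogeneous generator is split along 1 = sum of the vertices, so that every piece has its
   own vertex. *)
have fr : @framed K E M d ('I_(size s) * vert E)%type setT (fun p => p.2)
    (fun p => s`_p.1 *| (vx p.2 : R)) (fun p x => vx p.2 * phi p.1 x).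
  split.
  - move=> [i w] /=; rewrite -[d]addr0; apply: gm_act; first exact: hs.
    exact: (homog_gen K (LVert w)).
  - by move=> [i w] /=; rewrite -ractA vertM eqxx.
  - move=> [i w] /=; have h := hphi i (ltn_ord i); apply: functionalI.
    + by move=> x y; rewrite (functionalD h) mulrDr.
    + by move=> x a; rewrite (functional_act h) mulrA.
    + move=> k x hx; rewrite -[k - d]add0r; apply: homogM.
        exact: (homog_gen K (LVert w)).
      exact: (functional_homog h).
  - by move=> [i w] x /=; rewrite mulrA vertM eqxx.
  - move=> x; rewrite [LHS]sphi.
    rewrite (eq_bigl (fun p => xpredT p.1 && xpredT p.2)); last by move=> p; rewrite inE.
    rewrite -(pair_big xpredT xpredT (fun (i : 'I_(size s)) w =>
      s`_i *| (vx w : R) *| (vx w * phi i x : R))) /=.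
    apply: eq_bigr => i _.
    rewrite -[phi i x in LHS]mul1r [1]leavitt_oneE mulr_suml ract_sumr.
    by apply: eq_bigr => w _; rewrite -!ractA mulrA vertM eqxx.
(* Refinement makes the Gram matrix of this frame scalar, and [frame_shrink] then makes the frame
   dual. *)
have [n0 hn0] := gram_diagonal hE fr (fr_deg fr).
have [I [S [v [m [psi [fr' sub _ _]]]]]] := framed_refine_iter hE n0 fr.
have [|S' [psi' [fr2 du]]] := frame_shrink fr'.
  move=> k l; have [k0 [p [hp _ ->]]] := sub k; have [l0 [q [hq -> _]]] := sub l.
  by rewrite (functional_act (fr_fun fr k0)) mulrA; apply: hn0 hq.
by exists (d + n0%:Z), I, S', v, m, psi'.
Qed.

End FrameExistence.

(** * The modules vL(E) *)

Section VertexModule.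
Variables (K : fieldType) (E : digraph) (v : vert E).
Notation R := (leavitt_gr K E).
Notation L := (leavitt K E).
Notation vx v := (lpa_of_gen K (LVert v) : L).

(** As v is idempotent, its right ideal is the set of elements fixed by left multiplication with v;
    a boolean equation gives a subtype directly. *)
Definition vmod_set : pred (L^c)^o := [pred x | vx v * (x : L) == (x : L)].

Lemma vmod_closed : submod_closed vmod_set.
Proof.
split=> [|a x y]; rewrite !inE; first by rewrite mulr0.
move=> /eqP hx /eqP hy.
by rewrite -[a *: x]/((x : L) * (a : L)) mulrDr mulrA hx hy.
Qed.

HB.instance Definition _ := GRing.isSubmodClosed.Build _ _ vmod_set vmod_closed.

Record vmod := VMod { vmod_val : (L^c)^o; vmod_valP : vmod_val \in vmod_set }.

HB.instance Definition _ := [isSub for vmod_val].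
HB.instance Definition _ := [Choice of vmod by <:].
HB.instance Definition _ := [SubChoice_isSubLmodule of vmod by <:].

Lemma vmod_valE (x : vmod) : vx v * (vmod_val x : L) = vmod_val x.
Proof. by have := vmod_valP x; rewrite inE => /eqP. Qed.

Lemma vmod_val_sum (I : Type) (r : seq I) (P : pred I) (f : I -> vmod) :
  vmod_val (\sum_(i <- r | P i) f i) = \sum_(i <- r | P i) vmod_val (f i).
Proof. by apply: (big_morph vmod_val). Qed.

Lemma vmod_proj_subproof (x : L) : (vx v * x : (L^c)^o) \in vmod_set.
Proof. by rewrite inE mulrA vertM eqxx. Qed.

Definition vmod_proj (x : (L^c)^o) : vmod := VMod (vmod_proj_subproof x).

Lemma vmod_projK x : vmod_proj (vmod_val x) = x.
Proof. by apply: val_inj; apply: vmod_valE. Qed.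

Lemma vmod_proj_linear : linear vmod_proj.
Proof.
move=> a x y; apply: val_inj; rewrite /= mulrDr; congr (_ + _).
by rewrite -[a *: x]/((x : L) * (a : L)) mulrA.
Qed.

Lemma vmod_grading : @is_grading vmod (fun i x => lpa_homog i (vmod_val x : L)).
Proof.
have gL := lpa_is_grading K E; split=> [i|i x y|x|s f us hf fs i si].
- exact: homog0.
- exact: (gradingB gL).
- have [s [hs es]] := lpa_homog_sum (vmod_val x : L).
  exists [seq (p.1, vmod_proj p.2) | p <- s]; split.
    move=> q /mapP[p ps ->] /=; rewrite -[p.1]add0r.
    by apply: homogM (hs p ps); apply: (homog_gen K (LVert v)).
  rewrite big_map /= -[LHS]vmod_projK [vmod_val x]es.
  have pD : {morph vmod_proj : a b / a + b}.
    by move=> a b; have := vmod_proj_linear 1 a b; rewrite !scale1r.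
  by apply: (big_morph _ pD); apply: val_inj; rewrite /= mulr0.
- apply: val_inj; apply: (grading_direct gL us hf _ si).
  by rewrite -[LHS]vmod_val_sum fs.
Qed.

Lemma vmod_act i j (x : vmod) (a : L) : lpa_homog i (vmod_val x : L) ->
  lpa_homog j a -> lpa_homog (i + j) (vmod_val ((a : L^c) *: x) : L).
Proof. exact: homogM. Qed.

Definition gr_vmod : grMod R := @GrMod R vmod _ vmod_grading vmod_act.

Lemma fin_gen_vmod : fin_gen gr_vmod.
Proof.
exists 1%N, (fun=> vmod_proj (1 : L)) => x; exists (fun=> vmod_val x).
rewrite big_ord1; apply/esym/val_inj.
by rewrite -[LHS]/(vx v * (1 : L) * (vmod_val x : L)) mulr1; apply: vmod_valE.
Qed.

(** A direct summand of the regular module, by [vmod_proj] and [vmod_val]: maps are lifted on the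
    regular module and restricted. *)
Lemma gr_projective_vmod : gr_projective gr_vmod.
Proof.
move=> A B p b hp sp hb.
have hpr : @gr_hom R (gr_regular R) gr_vmod vmod_proj.
  split; first exact: vmod_proj_linear.
  move=> i x hx; rewrite -[i]add0r; apply: homogM hx.
  exact: (homog_gen K (LVert v)).
have hval : @gr_hom R gr_vmod (gr_regular R) vmod_val by split.
have [h [hh eh]] := gr_projective_regular hp sp (gr_hom_comp hpr hb).
exists (h \o vmod_val); split; first exact: gr_hom_comp hval hh.
by move=> x; rewrite /= eh /= vmod_projK.
Qed.

Definition fgp_vmod : fgpMod R := FgpMod fin_gen_vmod gr_projective_vmod.

End VertexModule.

(** * Dual frames of sums, of vertex modules and of the regular module *)

Section FrameConstructions.
Variables (K : fieldType) (E : digraph).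
Notation R := (leavitt_gr K E).
Notation L := (leavitt K E).
Notation vx v := (lpa_of_gen K (LVert v) : L).
Implicit Types (M N : grMod R) (d : int).

Definition framing M d (I : finType) (S : {set I}) (v : I -> vert E) : Prop :=
  exists m phi, @framed K E M d I S v m phi /\ dual_frame S v m phi.

Lemma framing_iso M N d (I : finType) (S : {set I}) v :
  gr_iso M N -> framing M d S v -> framing N d S v.
Proof.
move=> [f [hf [g fK gK]]] [m [phi [fr du]]].
have hg := gr_hom_inv hf fK gK.
exists (f \o m), (fun k x => phi k (g x)); split; last first.
  by move=> k l kS lS; rewrite /= fK; apply: du.
split=> [k|k|k|k x|x] /=.
- by apply: hf.2; apply: fr_deg fr _.
- by rewrite -(gr_hom_act _ _ hf) (fr_vert fr).
- exact: gr_hom_comp hg (fr_fun fr k).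
- exact: fr_cov fr _ _.
rewrite -[LHS]gK {1}(fr_sum fr (g x)) (gr_hom_sum _ _ _ hf).
by apply: eq_bigr => k _; rewrite (gr_hom_act _ _ hf).
Qed.

(** The hypothesis on sums expresses that h covers S; together with injectivity on S' it carries
    over both the expansion and the duality. *)
Lemma framing_reindex M d (I I' : finType) (S : {set I}) (S' : {set I'}) v
    (h : I' -> I) :
  (forall F : I -> M, \sum_(k in S) F k = \sum_(k in S') F (h k)) ->
  {in S', forall k, h k \in S} -> {in S' &, injective h} ->
  framing M d S v -> framing M d S' (fun k => v (h k)).
Proof.
move=> hsum hS hinj [m [phi [fr du]]].
exists (fun k => m (h k)), (fun k => phi (h k)); split; last first.
  move=> k l kS lS; rewrite du ?hS //.
  by case: (k =P l) => [->|nkl]; [rewrite eqxx|case: eqP => // /hinj e; case: nkl; apply: e].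
split=> [k|k|k|k x|x].
- exact: fr_deg fr _.
- exact: fr_vert fr _.
- exact: fr_fun fr _.
- exact: fr_cov fr _ _.
by rewrite -(hsum (fun k => m k *| (phi k x : R))) -(fr_sum fr x).
Qed.

(** Coordinates in one frame are used as coefficients in the other; duality makes the two maps
    inverse to each other. *)
Lemma framing_same_iso M N d (I : finType) (S : {set I}) v :
  framing M d S v -> framing N d S v -> gr_iso M N.
Proof.
have hom M1 N1 m phi n psi : @framed K E M1 d I S v m phi ->
    @framed K E N1 d I S v n psi ->
    gr_hom (fun x => \sum_(k in S) n k *| (phi k x : R)).
  move=> fr fr'; split=> [a x y|i x hx].
    rewrite scaler_sumr -big_split; apply: eq_bigr => k _ /=.
    rewrite (functionalD (fr_fun fr k)) ractDr; congr (_ + _).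
    rewrite -[a *: x]/(x *| (a : R)) (functional_act (fr_fun fr k)).
    by rewrite ractA.
  apply: (grading_bigsum (gm_grading N1)) => k _ _.
  have -> : i = d + (i - d) by lia.
  by apply: gm_act; [apply: fr_deg fr' _|apply: (functional_homog (fr_fun fr k))].
have can M1 N1 m phi n psi : @framed K E M1 d I S v m phi ->
    @framed K E N1 d I S v n psi -> dual_frame S v n psi ->
    forall x, \sum_(k in S) m k *| (psi k (\sum_(k in S) n k *| (phi k x : R)) : R) = x.
  move=> fr fr' du x; rewrite [RHS](fr_sum fr x); apply: eq_bigr => k kS.
  rewrite (functional_sum (fr_fun fr' k)) (bigD1 k) //= big1 => [|l /andP[lS nlk]].
    by rewrite addr0 (functional_act (fr_fun fr' k)) du // eqxx (fr_cov fr).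
  by rewrite (functional_act (fr_fun fr' k)) du // eq_sym (negbTE nlk) mul0r.
move=> [m [phi [fr du]]] [n [psi [fr' du']]].
exists (fun x => \sum_(k in S) n k *| (phi k x : R)); split; first exact: hom fr fr'.
exists (fun x => \sum_(k in S) m k *| (psi k x : R)) => x.
  exact: can fr fr' du' x.
exact: can fr' fr du x.
Qed.

Lemma framing_sum M N d (I J : finType) (S : {set I}) (T : {set J}) v w :
  framing M d S v -> framing N d T w ->
  framing (gr_sum M N) d
    [set k : I + J | match k with inl i => i \in S | inr j => j \in T end]
    (fun k => match k with inl i => v i | inr j => w j end).
Proof.
move=> [m [phi [fr du]]] [n [psi [fr' du']]].
exists (fun k => match k with inl i => (m i, 0) | inr j => (0, n j) end : gr_sum M N),
  (fun k x => match k with inl i => phi i x.1 | inr j => psi j x.2 end).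
split; last first.
  move=> [i|j] [i'|j']; rewrite !inE => hi hj /=.
  - exact: du.
  - exact: (functional0 (fr_fun fr i)).
  - exact: (functional0 (fr_fun fr' j)).
  - exact: du'.
split.
- move=> [i|j]; split=> /=; try exact: (grading0 (gm_grading _)).
    exact: fr_deg fr _.
  exact: fr_deg fr' _.
- case=> [i|j]; congr pair; rewrite /= ?scaler0 //.
    exact: fr_vert fr _.
  exact: fr_vert fr' _.
- move=> [i|j]; apply: functionalI => [x y|x a|k x []].
  + exact: (functionalD (fr_fun fr i)).
  + exact: (functional_act (fr_fun fr i) x.1).
  + by move=> h _; apply: (functional_homog (fr_fun fr i)).
  + exact: (functionalD (fr_fun fr' j)).
  + exact: (functional_act (fr_fun fr' j) x.2).
  + by move=> _ h; apply: (functional_homog (fr_fun fr' j)).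
- by move=> [i|j] x; [apply: fr_cov fr _ _|apply: fr_cov fr' _ _].
move=> x; rewrite big_sumType /=.
rewrite (eq_bigr (fun i => ((m i *| (phi i x.1 : R), 0) : gr_sum M N))); last first.
  by move=> i _; congr pair; rewrite /= scaler0.
rewrite [X in _ + X](eq_bigr (fun j => ((0, n j *| (psi j x.2 : R)) : gr_sum M N))); last first.
  by move=> j _; congr pair; rewrite /= scaler0.
rewrite gr_sum_suml gr_sum_sumr.
rewrite [LHS]surjective_pairing; congr pair; rewrite /= ?addr0 ?add0r.
  by rewrite [LHS](fr_sum fr); apply: eq_bigl => i; rewrite inE.
by rewrite [LHS](fr_sum fr'); apply: eq_bigl => i; rewrite inE.
Qed.

Lemma framing_vmod d (w : vert E) :
  framing (gr_shift (- d) (gr_vmod K w)) d [set: unit] (fun=> w).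
Proof.
exists (fun=> vmod_proj w (1 : L)), (fun _ x => vmod_val x); split; last first.
  by move=> [] [] _ _ /=; rewrite mulr1.
split=> //.
- move=> _ /=; rewrite mulr1 subrr; exact: (homog_gen K (LVert w)).
- by move=> _; apply: val_inj; rewrite /= mulr1 -[LHS]/(vx w * vx w) vertM eqxx.
- by move=> _ x; apply: vmod_valE.
- move=> x; rewrite (eq_bigl xpredT) => [|i]; last by rewrite inE.
  rewrite (big_pred1 tt) => [|[]//]; apply/esym/val_inj.
  by rewrite -[LHS]/(vx w * (1 : L) * (vmod_val x : L)) mulr1; apply: vmod_valE.
Qed.

Lemma framing_zero d (v : 'I_0 -> vert E) : framing (gr_zero R) d [set: 'I_0] v.
Proof.
exists (fun=> 0), (fun _ _ => 0); split; last by case.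
split=> //; try by case.
by move=> x; apply/rowP; case.
Qed.

Lemma framing_regular : framing (gr_regular R) 0 [set: vert E] id.
Proof.
exists (fun w => vx w : R), (fun w x => vx w * (x : L)); split; last first.
  by move=> w u _ _; rewrite vertM.
split=> [w|w|w|w x|x].
- exact: (homog_gen K (LVert w)).
- by rewrite -[LHS]/(vx w * vx w) vertM eqxx.
- apply: functionalI => [x y|x a|i x hx]; first exact: mulrDr.
    exact: mulrA.
  by rewrite subr0 -[i]add0r; apply: homogM hx; apply: (homog_gen K (LVert w)).
- by rewrite mulrA vertM eqxx.
rewrite (eq_bigr (fun w => vx w * (x : L))) => [|w _]; last first.
  by rewrite -[LHS]/(vx w * (vx w * (x : L))) mulrA vertM eqxx.
rewrite -mulr_suml (eq_bigl xpredT) => [|i]; last by rewrite inE.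
by rewrite -leavitt_oneE; apply/esym; apply: (mul1r (x : L)).
Qed.

End FrameConstructions.

(** * Presentation of K_0^gr *)

Lemma iter_adj_stepD (E : digraph) n (a b : vert E -> nat) :
  iter n (@adj_step E) (fun w => a w + b w)%N =1
  fun w => (iter n (@adj_step E) a w + iter n (@adj_step E) b w)%N.
Proof.
elim: n => // n IH w; rewrite !iterS /adj_step -big_split.
by apply: eq_bigr => u _; rewrite IH mulnDl.
Qed.

Section K0Leavitt.
Variables (K : fieldType) (E : digraph).
Notation R := (leavitt_gr K E).
Hypothesis hE : no_sinks E.

Definition k0_vert (d : int) (w : vert E) : K0gr R :=
  k0_class (fgp_shift (- d) (fgp_vmod K w)).

Lemma k0_vert_act j d w : zx_act j (k0_vert d w) = k0_vert (d - j) w.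
Proof.
rewrite /k0_vert k0_class_act opprB /k0_class; congr gc_inj; apply/vclassP.
exact/gr_iso_sym/gr_iso_shiftD.
Qed.

Lemma k0_classD (M N : fgpMod R) : k0_class (fgp_sum M N) = k0_class M + k0_class N.
Proof. by rewrite /k0_class -vclassD gc_injD. Qed.

Fixpoint vmod_sum (d : int) n : ('I_n -> vert E) -> fgpMod R :=
  match n with
  | 0%N => fun=> fgp_zero R
  | n'.+1 => fun v => fgp_sum (fgp_shift (- d) (fgp_vmod K (v ord0)))
                       (vmod_sum d (fun i => v (lift ord0 i)))
  end.

Lemma k0_vmod_sum d n (v : 'I_n -> vert E) :
  k0_class (vmod_sum d v) = \sum_i k0_vert d (v i).
Proof.
elim: n v => [|n IH] v; first by rewrite big_ord0.
by rewrite /= k0_classD IH big_ord_recl.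
Qed.

Lemma framing_vmod_sum d n (v : 'I_n -> vert E) : framing (vmod_sum d v) d setT v.
Proof.
elim: n v => [|n IH] v; first exact: framing_zero.
have := framing_sum (framing_vmod K d (v ord0)) (IH (fun i => v (lift ord0 i))).
set g := (X in framing _ _ _ X) => fr.
pose h (k : 'I_n.+1) : unit + 'I_n := oapp inr (inl tt) (unlift ord0 k).
have ev : (fun k => g (h k)) = v.
  by apply/funext => k; rewrite /h; case: unliftP => [j|] ->.
rewrite -[X in framing _ _ _ X]ev.
apply: (framing_reindex _ _ _ fr) => [F|k _|k l _ _].
- rewrite (eq_bigl xpredT) => [|[i|i]]; rewrite ?inE //.
  rewrite big_sumType /= (big_pred1 tt) => [|[]//].
  rewrite [RHS](eq_bigl xpredT) => [|i]; last by rewrite inE.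
  rewrite big_ord_recl /h unlift_none /=; congr (_ + _).
  by apply: eq_bigr => i _; rewrite liftK.
- by rewrite inE; case: (h k) => *; rewrite inE.
- by rewrite /h; case: unliftP => [j|] ->; case: unliftP => [i|] -> //= [->].
Qed.

(** Enumeration of S gives M the same framing as an explicit sum of vertex modules, so the two are
    isomorphic. *)
Lemma framing_class (M : fgpMod R) d (I : finType) (S : {set I}) v :
  framing M d S v -> k0_class M = \sum_w k0_vert d w *+ vertex_count S v w.
Proof.
move=> fM; rewrite -vertex_count_sum.
have fM' : framing M d [set: 'I_#|S|] (fun i => v (enum_val i)).
  apply: (framing_reindex _ _ _ fM) => [F|k _|k l _ _].
  - rewrite [LHS]big_enum_val; apply: eq_bigl => i; by rewrite inE.
  - exact: enum_valP.
  - exact: enum_val_inj.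
have := framing_same_iso fM' (framing_vmod_sum d (fun i => v (enum_val i))).
move=> /vclassP e; rewrite /k0_class e -/(k0_class _) k0_vmod_sum.
by rewrite [RHS]big_enum_val.
Qed.

Definition framing_type (M : grMod R) (d : int) (a : vert E -> nat) : Prop :=
  exists (I : finType) (S : {set I}) v, framing M d S v /\ vertex_count S v =1 a.

Lemma framing_type_iter M d a n : framing_type M d a ->
  framing_type M (d + n%:Z) (iter n (@adj_step E) a).
Proof.
move=> [I [S [v [[m [phi [fr du]]] /funext <-]]]].
have [I' [S' [v' [m' [phi' [fr' _ du' cnt]]]]]] := framed_refine_iter hE n fr.
by exists I', S', v'; split=> //; exists m', phi'; split=> //; apply: du'.
Qed.

Lemma framing_type_sum M N d a b : framing_type M d a -> framing_type N d b ->
  framing_type (gr_sum M N) d (fun w => a w + b w)%N.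
Proof.
move=> [I [S [v [fM ca]]]] [J [T [w [fN cb]]]].
exists (I + J)%type, [set k : I + J | match k with inl i => i \in S | inr j => j \in T end],
  (fun k => match k with inl i => v i | inr j => w j end).
split=> [|u]; first exact: framing_sum.
rewrite -ca -cb /vertex_count -!sum1_card big_mkcond big_sumType -!big_mkcond /=.
by congr addn; apply: eq_bigl => i; rewrite !inE.
Qed.

Lemma framing_type_unique (M N : grMod R) d a b : gr_iso M N ->
  framing_type M d a -> framing_type N d b ->
  exists n, iter n (@adj_step E) a =1 iter n (@adj_step E) b.
Proof.
move=> iMN [I [S [v [fM /funext <-]]]] [J [T [w [[n [psi [fr' du']]] /funext <-]]]].
have [m [phi [fr du]]] := framing_iso iMN fM.
exact: dual_frame_unique fr fr' du du'.
Qed.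

Lemma framing_type_exists (M : fgpMod R) : exists d a, framing_type M d a.
Proof.
have [d [I [S [v [m [phi [fr du]]]]]]] := frame_exists hE (fgp_fin_gen M) (@fgp_projective _ M).
by exists d, (vertex_count S v), I, S, v; split=> //; exists m, phi.
Qed.

Lemma framing_type_class (M : fgpMod R) d a : framing_type M d a ->
  k0_class M = \sum_w k0_vert d w *+ a w.
Proof. by move=> [I [S [v [/framing_class -> /funext ->]]]]. Qed.

Lemma framing_type_realize d (a : vert E -> nat) : exists M : fgpMod R, framing_type M d a.
Proof.
pose s := flatten [seq nseq (a w) w | w : vert E].
exists (vmod_sum d (tnth (in_tuple s))), 'I_(size s), setT, (tnth (in_tuple s)).
split=> [|w]; first exact: framing_vmod_sum.
rewrite /vertex_count -sum1_card.
rewrite (eq_bigl (fun k => tnth (in_tuple s) k == w)) => [|k]; last by rewrite !inE.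
rewrite -(big_tnth _ _ s (fun x => x == w) (fun=> 1%N)) sum1_count count_flatten.
rewrite sumnE big_map big_image /= (bigD1 w) //= big1 => [|u nuw].
  by rewrite addn0 count_nseq eqxx mul1n.
by rewrite count_nseq (negbTE nuw).
Qed.

(** One refinement of the framing of the shifted module by its single generator. *)
Lemma k0_vert_step d w :
  k0_vert d w = \sum_u k0_vert (d + 1) u *+ adjacency w u.
Proof.
have : framing_type (fgp_shift (- d) (fgp_vmod K w)) d (fun u => (u == w) : nat).
  exists unit, setT, (fun=> w); split=> [|u]; first exact: framing_vmod.
  rewrite /vertex_count; case: (u =P w) => [->|/eqP nuw].
    rewrite (eq_card (B := xpredT)) ?card_unit // => -[].
    by rewrite !inE eqxx.
  by apply/eqP; rewrite cards_eq0; apply/eqP/setP => i; rewrite !inE eq_sym (negbTE nuw).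
move=> /(framing_type_iter 1)/framing_type_class; rewrite -/(k0_vert _ _) => ->.
apply: eq_bigr => u _; congr (_ *+ _).
rewrite [LHS]/= /adj_step (bigD1 w) //= eqxx mul1n big1 ?addn0 // => z /negbTE ->.
by rewrite mul0n.
Qed.

Lemma k0_pos_vert (x : K0gr R) : zx_pos x ->
  exists d (a : vert E -> nat), x = \sum_w k0_vert d w *+ a w.
Proof.
move=> [y ->]; elim/vclassW: y => M.
have [d [a ha]] := framing_type_exists M.
by exists d, a; apply: framing_type_class.
Qed.

Lemma k0_vert_pos d w : zx_pos (k0_vert d w).
Proof. by eexists. Qed.

Lemma k0_split (x : K0gr R) : exists y z, [/\ zx_pos y, zx_pos z & x = y - z].
Proof.
elim/gc_diffW: x => a b; exists (gc_inj a), (gc_inj b).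
by split; [exists a|exists b|rewrite gc_diffE].
Qed.

(** Equality of classes is isomorphism after adding some Q. Once everything is refined to a common
    degree, uniqueness of vertex counts applies, and the count of Q cancels in the natural
    numbers. *)
Lemma k0_vert_eq d (a b : vert E -> nat) :
  \sum_w k0_vert d w *+ a w = \sum_w k0_vert d w *+ b w ->
  exists n, iter n (@adj_step E) a =1 iter n (@adj_step E) b.
Proof.
have [M hM] := framing_type_realize d a; have [N hN] := framing_type_realize d b.
rewrite -(framing_type_class hM) -(framing_type_class hN) => /k0_classP[Q iQ].
have [dQ [q hQ]] := framing_type_exists Q.
(* The degree [d + n] is at least [dQ], so both framings can be refined up to it. *)
pose n := absz (dQ - d)%R; pose n' := absz (d + n%:Z - dQ)%R.
have hQ' := framing_type_iter n' hQ.
have e : dQ + n'%:Z = d + n%:Z by rewrite /n' /n; lia.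
rewrite e in hQ'.
have [k hk] := framing_type_unique iQ
  (framing_type_sum (framing_type_iter n hM) hQ')
  (framing_type_sum (framing_type_iter n hN) hQ').
exists (k + n)%N => w; have := hk w.
by rewrite !iter_adj_stepD !iterD => /addIn.
Qed.

Lemma k0_regular : k0_class (fgp_regular R) = \sum_w k0_vert 0 w.
Proof.
rewrite (framing_class (M := fgp_regular R) (framing_regular K E)).
rewrite -(vertex_count_sum _ id); apply: eq_bigl => w; by rewrite inE.
Qed.

End K0Leavitt.

(** * The tensor product *)

Lemma morphD_sum (U W : zmodType) (f : U -> W) : {morph f : x y / x + y} ->
  forall (I : Type) (r : seq I) (P : pred I) (g : I -> U),
  f (\sum_(i <- r | P i) g i) = \sum_(i <- r | P i) f (g i).
Proof.
move=> fD I r P g; apply: (big_morph f fD).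
by apply: (addrI (f 0)); rewrite -fD !addr0.
Qed.

Lemma morphDz (U W : zmodType) (f : U -> W) : {morph f : x y / x + y} ->
  forall x (n : int), f (x *~ n) = f x *~ n.
Proof.
move=> fD x n.
have f0 : f 0 = 0 by apply: (addrI (f 0)); rewrite -fD !addr0.
have fn k : f (x *+ k) = f x *+ k by elim: k => // k IH; rewrite !mulrS fD IH.
case: n => k /=; first exact: fn.
apply: (addrI (f (x *+ k.+1))).
by rewrite -fD [LHS](_ : _ = 0) ?fn ?subrr // subrr f0.
Qed.

Lemma tens_sum (U V : zmodType) (I J : finType) (f : I -> U) (g : J -> V)
    (a : I -> int) (b : J -> int) :
  tens (\sum_i f i *~ a i) (\sum_j g j *~ b j) =
  \sum_p tens (f p.1) (g p.2) *~ (a p.1 * b p.2).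
Proof.
rewrite (morphD_sum (tensDl _)) -(pair_big xpredT xpredT
  (fun i j => tens (f i) (g j) *~ (a i * b j))) /=.
apply: eq_bigr => i _; rewrite (morphD_sum (@tensDr _ _ _)).
apply: eq_bigr => j _.
by rewrite (morphDz (@tensDr _ _ _)) (morphDz (tensDl _)) mulrzA.
Qed.

(** * Integer vectors at the levels of the direct limit *)

Definition adj_stepz (E : digraph) (a : vert E -> int) (w : vert E) : int :=
  \sum_u a u * (adjacency u w)%:Z.

(** The value on a vector a at level d of the map which sends the basis vector of w at that level to
    [q d w]; for a step-compatible q these maps agree along the limit. *)
Definition eval_at (E : digraph) (W : zmodType) (q : int -> vert E -> W)
    (d : int) (a : vert E -> int) : W := \sum_w q d w *~ a w.

Definition step_compatible (E : digraph) (W : zmodType) (q : int -> vert E -> W) :=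
  forall d w, q d w = \sum_u q (d + 1) u *+ adjacency w u.

Section Evaluation.
Variables (E : digraph) (W : zmodType) (q : int -> vert E -> W).

Lemma eval_atD d a b : eval_at q d (fun w => a w + b w) = eval_at q d a + eval_at q d b.
Proof. by rewrite -big_split; apply: eq_bigr => w _; rewrite mulrzDr. Qed.

Lemma eval_atB d a b : eval_at q d (fun w => a w - b w) = eval_at q d a - eval_at q d b.
Proof. by rewrite -sumrB; apply: eq_bigr => w _; rewrite mulrzBr. Qed.

Lemma eval_at_delta d w : eval_at q d (fun u => (u == w)%:Z) = q d w.
Proof.
rewrite /eval_at (bigD1 w) //= eqxx big1 ?addr0 ?mulr1z // => u /negbTE ->.
by rewrite mulr0z.
Qed.

Hypothesis hq : step_compatible q.

Lemma eval_at_iter n d a : eval_at q (d + n%:Z) (iter n (@adj_stepz E) a) = eval_at q d a.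
Proof.
elim: n => [|n IH]; first by rewrite addr0.
rewrite iterS -[RHS]IH /eval_at (_ : d + n.+1%:Z = d + n%:Z + 1); last by lia.
set b := iter _ _ _.
rewrite [RHS](eq_bigr (fun w => \sum_u q (d + n%:Z + 1) u *~ (b w * (adjacency w u)%:Z))).
  by rewrite exchange_big /=; apply: eq_bigr => u _; rewrite mulrz_sumr.
move=> w _; rewrite hq mulrz_suml; apply: eq_bigr => u _.
by rewrite pmulrn -mulrzA mulrC.
Qed.

End Evaluation.

Section IntegerSteps.
Variable E : digraph.
Implicit Types a b : vert E -> int.

Lemma adj_stepz_nat n (a : vert E -> nat) :
  iter n (@adj_stepz E) (fun w => (a w)%:Z) = fun w => (iter n (@adj_step E) a w)%:Z.
Proof.
elim: n => // n IH; apply/funext => w; rewrite !iterS IH /adj_step /adj_stepz.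
by rewrite (big_morph Posz PoszD erefl); apply: eq_bigr => u _; rewrite PoszM.
Qed.

Lemma adj_stepzB n a b : iter n (@adj_stepz E) (fun w => a w - b w) =
  fun w => iter n (@adj_stepz E) a w - iter n (@adj_stepz E) b w.
Proof.
elim: n => // n IH; apply/funext => w; rewrite !iterS IH /adj_stepz -sumrB.
by apply: eq_bigr => u _; rewrite mulrBl.
Qed.

End IntegerSteps.

(** A Kronecker product acts on a product vector factor by factor. *)
Lemma adj_stepz_tensor (E F : digraph) n a b :
  iter n (@adj_stepz (graph_tensor E F)) (fun p => a p.1 * b p.2) =
  fun p => iter n (@adj_stepz E) a p.1 * iter n (@adj_stepz F) b p.2.
Proof.
elim: n => // n IH; apply/funext => -[v w]; rewrite !iterS IH /adj_stepz /=.
set a' := iter _ _ a; set b' := iter _ _ b.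
rewrite mulr_suml -(pair_big xpredT xpredT (fun u u' => a' u * b' u' *
  (@adjacency (graph_tensor E F) (u, u') (v, w))%:Z)) /=.
apply: eq_bigr => u _; rewrite mulr_sumr; apply: eq_bigr => u' _.
by rewrite adjacency_graph_tensor PoszM mulrACA.
Qed.

(** * The direct limit presentation and its universal property *)

Section Presentation.
Variables (K : fieldType) (E : digraph).
Notation G := (K0gr (leavitt_gr K E)).
Notation p := (@k0_vert K E).
Hypothesis hE : no_sinks E.

Lemma k0_vert_compatible : step_compatible p.
Proof. by move=> d w; apply: k0_vert_step. Qed.

Lemma k0_pos_eval (x : G) : zx_pos x -> exists d0, forall d, d0 <= d ->
  exists a : vert E -> int, (forall w, 0 <= a w) /\ x = eval_at p d a.
Proof.
move=> /(k0_pos_vert hE)[d0 [a ->]]; exists d0 => d hd.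
exists (iter (absz (d - d0)%R) (@adj_stepz E) (fun w => (a w)%:Z)).
split; first by move=> w; rewrite adj_stepz_nat.
rewrite (_ : d = d0 + (absz (d - d0)%R)%:Z); last by lia.
by rewrite addrAC subrr add0r absz_nat (eval_at_iter k0_vert_compatible).
Qed.

Lemma k0_eval (x : G) : exists d0, forall d, d0 <= d -> exists a, x = eval_at p d a.
Proof.
have [y [z [/k0_pos_eval[d1 h1] /k0_pos_eval[d2 h2] ->]]] := k0_split x.
exists (Num.max d1 d2) => d; rewrite ge_max => /andP[/h1[a [_ ->]] /h2[b [_ ->]]].
by exists (fun w => a w - b w); rewrite eval_atB.
Qed.

Lemma k0_eval_eq d a b : eval_at p d a = eval_at p d b ->
  exists n, iter n (@adj_stepz E) a = iter n (@adj_stepz E) b.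
Proof.
move=> e.
(* The identity x = (x + |x|) - |x| writes [a - b] as a difference of nonnegative vectors, to which
   [k0_vert_eq] applies. *)
pose a' w := absz (a w - b w + `|a w - b w|)%R; pose b' w := absz `|a w - b w|%R.
have ab w : a w - b w = (a' w)%:Z - (b' w)%:Z by rewrite /a' /b'; lia.
have : eval_at p d (fun w => (a' w)%:Z) = eval_at p d (fun w => (b' w)%:Z).
  apply/eqP; rewrite -subr_eq0 -eval_atB -(funext ab) eval_atB e subrr //.
move=> /(k0_vert_eq hE)[n hn]; exists n; apply/funext => w.
apply/eqP; rewrite -subr_eq0; apply/eqP.
transitivity (iter n (@adj_stepz E) (fun w => a w - b w) w); first by rewrite adj_stepzB.
by rewrite (funext ab) adj_stepzB !adj_stepz_nat hn subrr.
Qed.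

(** Vectors that meet at one level agree at all later ones. A threshold, instead of a single level,
    lets several such equalities be used together. *)
Lemma k0_common_level d d' a a' : eval_at p d a = eval_at p d' a' ->
  exists l, forall n n', l <= d + n%:Z -> d + n%:Z = d' + n'%:Z ->
  iter n (@adj_stepz E) a = iter n' (@adj_stepz E) a'.
Proof.
pose m := absz (d' - d)%R; pose m' := absz (d + m%:Z - d')%R.
have e : d + m%:Z = d' + m'%:Z by rewrite /m' /m; lia.
rewrite -(eval_at_iter k0_vert_compatible m) -(eval_at_iter k0_vert_compatible m' d').
rewrite -e => /k0_eval_eq[k]; rewrite -!iterD => h.
exists (d + (k + m)%N%:Z) => n n' hn en.
have -> : n = ((n - (k + m)) + (k + m))%N by lia.
have -> : n' = ((n - (k + m)) + (k + m'))%N by lia.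
by rewrite iterD h -iterD.
Qed.

Lemma k0_ind_morph (W : zmodType) (f g : G -> W) :
  {morph f : x y / x + y} -> {morph g : x y / x + y} ->
  (forall d w, f (p d w) = g (p d w)) -> f =1 g.
Proof.
move=> fD gD h x; have [d /(_ d (lexx d))[a ->]] := k0_eval x.
rewrite (morphD_sum fD) (morphD_sum gD); apply: eq_bigr => w _.
by rewrite (morphDz fD) (morphDz gD) h.
Qed.

(** Any representation of an element may be used: two of them coincide at a high level, and moving
    up does not change the value of a compatible family. *)
Lemma k0_universal (W : zmodType) (q : int -> vert E -> W) : step_compatible q ->
  exists f : G -> W, {morph f : x y / x + y} /\ forall d a, f (eval_at p d a) = eval_at q d a.
Proof.
move=> hq.
have /choice[f hf] : forall x : G, exists y, exists d a, x = eval_at p d a /\ y = eval_at q d a.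
  move=> x; have [d /(_ d (lexx d))[a ->]] := k0_eval x.
  by exists (eval_at q d a), d, a.
have fE d a : f (eval_at p d a) = eval_at q d a.
  have [d' [a' [e ->]]] := hf (eval_at p d a).
  have [l hl] := k0_common_level e.
  (* This makes [d + n] at least l and at least [d']. *)
  pose n := (absz (l - d)%R + absz (d' - d)%R)%N; pose n' := absz (d + n%:Z - d')%R.
  have en : d + n%:Z = d' + n'%:Z by rewrite /n' /n; lia.
  rewrite -(eval_at_iter hq n d) -(eval_at_iter hq n' d') (hl n n') ?en //.
  by rewrite -en /n; lia.
exists f; split=> // x y.
have [d1 h1] := k0_eval x; have [d2 h2] := k0_eval y.
have [|a ea] := h1 (Num.max d1 d2); first by rewrite le_max lexx.
have [|b eb] := h2 (Num.max d1 d2); first by rewrite le_max lexx orbT.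
by rewrite ea eb -eval_atD !fE eval_atD.
Qed.

End Presentation.

(** * The isomorphism and its positivity *)

Section PosSums.
Variable G : poZXmod.

Lemma zx_pos_sum (I : Type) (r : seq I) (P : pred I) (f : I -> G) :
  (forall i, zx_pos (f i)) -> zx_pos (\sum_(i <- r | P i) f i).
Proof. by move=> h; elim/big_ind: _ => //; [exact: zx_pos0|exact: zx_posD]. Qed.

Lemma zx_posMn (x : G) n : zx_pos x -> zx_pos (x *+ n).
Proof.
move=> hx; elim: n => [|n IH]; first exact: zx_pos0.
by rewrite mulrS; apply: zx_posD.
Qed.

End PosSums.

Lemma no_sinks_tensor (E F : digraph) : no_sinks E -> no_sinks F ->
  no_sinks (graph_tensor E F).
Proof.
move=> hE hF [v w]; have [e ee] := hE v; have [f ff] := hF w.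
have h : (0 < adjacency v (rng e) * adjacency w (rng f))%N.
  rewrite muln_gt0; apply/andP; split; apply/card_gt0P.
    by exists e; rewrite inE ee !eqxx.
  by exists f; rewrite inE ff !eqxx.
by exists (existT _ ((v, w), (rng e, rng f)) (Ordinal h)).
Qed.

Theorem theorem11 (K : fieldType) (E F : digraph)
    (hE : no_sinks E) (hF : no_sinks F) :
  exists phi : K0gr (leavitt_gr K (graph_tensor E F)) ->
               zx_tensor (K0gr (leavitt_gr K E)) (K0gr (leavitt_gr K F)),
    order_preserving_iso phi /\
    phi (k0_class (fgp_regular (leavitt_gr K (graph_tensor E F)))) =
      tens (k0_class (fgp_regular (leavitt_gr K E)))
           (k0_class (fgp_regular (leavitt_gr K F))).
Proof.
have hT := no_sinks_tensor hE hF.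
pose pE := @k0_vert K E; pose pF := @k0_vert K F.
pose pT := @k0_vert K (graph_tensor E F).
pose GE := K0gr (leavitt_gr K E); pose GF := K0gr (leavitt_gr K F).
pose q (d : int) (p : vert (graph_tensor E F)) : tensZ GE GF := tens (pE d p.1) (pF d p.2).
have evalq d a b : eval_at q d (fun p => a p.1 * b p.2) =
    tens (eval_at pE d a) (eval_at pF d b) by rewrite tens_sum.
(* Expanding both factors one level up gives products of adjacency entries, which are the entries of
   the Kronecker product. *)
have hq : step_compatible q.
  move=> d [v w].
  rewrite /q /= {1}/pE {1}/pF (k0_vert_compatible K hE) (k0_vert_compatible K hF).
  rewrite (tens_sum (pE (d + 1)) (pF (d + 1)) (fun u => (adjacency v u)%:Z)
    (fun z => (adjacency w z)%:Z)).
  by apply: eq_bigr => -[u z] _; rewrite adjacency_graph_tensor.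
have [phi [phiD phiE]] := k0_universal K hT hq.
have phiP d p : phi (pT d p) = q d p by rewrite -(eval_at_delta pT) phiE eval_at_delta.
(* The inverse on pure tensors: both factors are written at one level and the product of their
   coefficient vectors is evaluated there. [psi0E] shows that the chosen representation does not
   matter. *)
have /choice[psi0 hpsi0] : forall xy : GE * GF, exists z, exists d a b,
    [/\ xy.1 = eval_at pE d a, xy.2 = eval_at pF d b
      & z = eval_at pT d (fun p => a p.1 * b p.2)].
  move=> [x y]; have [d1 h1] := k0_eval hE x; have [d2 h2] := k0_eval hF y.
  have [|a ->] := h1 (Num.max d1 d2); first by rewrite le_max lexx.
  have [|b ->] := h2 (Num.max d1 d2); first by rewrite le_max lexx orbT.
  by eexists; exists (Num.max d1 d2), a, b.
have psi0E d a b : psi0 (eval_at pE d a, eval_at pF d b) =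
    eval_at pT d (fun p => a p.1 * b p.2).
  have [d' [a' [b' [/= ea eb ->]]]] := hpsi0 (eval_at pE d a, eval_at pF d b).
  have [l1 hl1] := k0_common_level hE ea; have [l2 hl2] := k0_common_level hF eb.
  (* At level [d + n], which is above [l1], [l2] and [d'], the representations of both factors have
     become equal. *)
  pose n := (absz (l1 - d)%R + absz (l2 - d)%R + absz (d' - d)%R)%N.
  pose n' := absz (d + n%:Z - d')%R.
  have en : d + n%:Z = d' + n'%:Z by rewrite /n' /n; lia.
  have hc := k0_vert_compatible K hT.
  rewrite -(eval_at_iter hc n d) -(eval_at_iter hc n' d') !adj_stepz_tensor -en.
  rewrite (hl1 n n') ?(hl2 n n') //; by rewrite /n; lia.
have levels (x x' : GE) (y y' : GF) : exists d a a' b b',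
    [/\ x = eval_at pE d a, x' = eval_at pE d a', y = eval_at pF d b & y' = eval_at pF d b'].
  have [d1 h1] := k0_eval hE x; have [d2 h2] := k0_eval hE x'.
  have [d3 h3] := k0_eval hF y; have [d4 h4] := k0_eval hF y'.
  pose d : int := `|d1| + `|d2| + `|d3| + `|d4|.
  have [|a ->] := h1 d; first by rewrite /d; lia.
  have [|a' ->] := h2 d; first by rewrite /d; lia.
  have [|b ->] := h3 d; first by rewrite /d; lia.
  have [|b' ->] := h4 d; first by rewrite /d; lia.
  by exists d, a, a', b, b'.
pose bil (x : GE) (y : GF) := psi0 (x, y).
have bilDl y : {morph bil^~ y : x x' / x + x'}.
  move=> x x'; have [d [a [a' [b [_ [-> -> -> _]]]]]] := levels x x' y y.
  rewrite /bil -eval_atD !psi0E -eval_atD; congr eval_at.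
  by apply/funext => p; rewrite mulrDl.
have bilDr x : {morph bil x : y y' / y + y'}.
  move=> y y'; have [d [a [_ [b [b' [-> _ -> ->]]]]]] := levels x x y y'.
  rewrite /bil -eval_atD !psi0E -eval_atD; congr eval_at.
  by apply/funext => p; rewrite mulrDr.
pose psi := tens_lift bil.
have psiD : {morph psi : x y / x + y} := tens_liftD bilDl bilDr.
have psi_phi : cancel phi psi.
  apply: (k0_ind_morph hT (f := psi \o phi) (g := id)) => //= [x y|d [v w]].
    by rewrite /= phiD psiD.
  rewrite /= phiP /psi /q (tens_liftE bilDl bilDr) /bil.
  (* Generators are evaluated as delta vectors, whose product is the delta vector of the pair. *)
  rewrite -(eval_at_delta pE d v) -(eval_at_delta pF d w) psi0E /=.
  rewrite -[RHS](eval_at_delta pT); congr eval_at.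
  by apply/funext => -[u z] /=; rewrite xpair_eqE; do 2![case: (_ == _)].
have phi_psi : cancel psi phi.
  apply: (morphD_eq_tens (f := phi \o psi) (g := id)) => //= [x y|x y].
    by rewrite /= psiD phiD.
  have [d [a [_ [b [_ [-> _ -> _]]]]]] := levels x x y y.
  by rewrite /= /psi (tens_liftE bilDl bilDr) /bil psi0E phiE evalq.
exists phi; split; last first.
  rewrite !k0_regular // (morphD_sum phiD).
  (* The coefficients are written as 1 * 1 to match the expansion of a tensor of two sums. *)
  rewrite (eq_bigr (fun p : vert E * vert F => q 0 p *~ (1 * 1))) => [|p _]; last exact: phiP.
  have := tens_sum (pE 0) (pF 0) (fun=> 1) (fun=> 1) => <-.
  by congr tens; apply: eq_bigr => w _.
split=> //.
- move=> j; apply: (k0_ind_morph hT (f := fun g => phi (zx_act j g))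
    (g := fun g => zxtens_act j (phi g))).
  + by move=> x y; rewrite zx_actDr phiD.
  + by move=> x y; rewrite phiD zxtens_actDr.
  + by move=> d p; rewrite k0_vert_act !phiP zxtens_actE !k0_vert_act.
- by exists psi.
move=> h; split=> [|[g /(k0_pos_vert hT)[d [a ->]] <-]]; last first.
  rewrite (morphD_sum phiD); elim/big_ind: _ => [|x y|p _].
  + exact: zxtens_pos0.
  + exact: zxtens_posD.
  rewrite -[_ *+ _]/(_ *~ (a p)%:Z) (morphDz phiD) phiP -pmulrn.
  elim: (a p) => [|n IH]; first exact: zxtens_pos0.
  rewrite mulrS; apply: zxtens_posD => //; apply: zxtens_pos_pure; exact: k0_vert_pos.
elim=> {h} [|x y /(k0_pos_eval hE)[d1 h1] /(k0_pos_eval hF)[d2 h2]|x y _ [g hg <-] _ [g' hg' <-]].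
- exists 0; first exact: zx_pos0.
  by apply: (addrI (phi 0)); rewrite -phiD !addr0.
(* Nonnegative coefficients of the two factors at a common level have nonnegative products, which
   give a positive preimage. *)
- have [|a [a0 ->]] := h1 (Num.max d1 d2); first by rewrite le_max lexx.
  have [|b [b0 ->]] := h2 (Num.max d1 d2); first by rewrite le_max lexx orbT.
  exists (eval_at pT (Num.max d1 d2) (fun p => a p.1 * b p.2)); last by rewrite phiE evalq.
  apply: zx_pos_sum => p; rewrite -(gez0_abs (a0 p.1)) -(gez0_abs (b0 p.2)).
  exact/zx_posMn/k0_vert_pos.
- by exists (g + g'); [apply: zx_posD|rewrite phiD].
Qed.
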